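(* Let $V$ be a unital Jordan superalgebra over a field $\mathbb{K}$ of characteristic different from $2$ and $3$. Then $\mathrm{Kan}(V)\cong\mathrm{Ko}(V)$ as Lie superalgebras.
   Context: $\mathbb{K}$ is a field of characteristic $\neq 2,3$. Super vector spaces $V=V_{\bar 0}\oplus V_{\bar 1}$ are not assumed finite dimensional; $|x|\in\mathbb{Z}/2\mathbb{Z}$ is the parity of a homogeneous $x$; formulas with signs are for homogeneous elements and extended linearly; $[A,B]=AB-(-1)^{|A||B|}BA$ is the supercommutator on $\mathrm{End}(V)$. A Jordan superalgebra is a super vector space $V$ with a bilinear product satisfying $V_iV_j\subset V_{i+j}$, $xy=(-1)^{|x||y|}yx$, and $(-1)^{|x||z|}[L_x,L_{yz}]+(-1)^{|y||x|}[L_y,L_{zx}]+(-1)^{|z||y|}[L_z,L_{xy}]=0$, where $L_x(y)=xy$. It is unital if there is $e\in V$ with $ex=x=xe$ for all $x$. Kantor's construction: $\mathrm{Kan}(V)=\mathfrak{g}_-\oplus\mathfrak{g}_0\oplus\mathfrak{g}_+$ with $\mathfrak{g}_-=V$; $\mathfrak{g}_0=\mathfrak{istr}(V)=\langle L_a,[L_a,L_b]\mid a,b\in V\rangle\subset\mathrm{End}(V)$; and $\mathfrak{g}_+=\langle P,[L_a,P]\mid a\in V\rangle\subset\mathrm{End}(V\otimes V,V)$ (linear maps $V\otimes V\to V$), where $P(x,y)=xy$ and $[L_a,P](x,y)=a(xy)-(ax)y-(-1)^{|x||y|}(ay)x$. The Lie superbracket (extended by super-antisymmetry) is: $[\mathfrak{g}_-,\mathfrak{g}_-]=0=[\mathfrak{g}_+,\mathfrak{g}_+]$;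 the supercommutator on $\mathfrak{g}_0$; $[a,x]=a(x)$ for $a\in\mathfrak{g}_0,x\in\mathfrak{g}_-$; $[A,x](y)=A(x,y)$ for $A\in\mathfrak{g}_+$, $x,y\in\mathfrak{g}_-$; and $[a,B](x,y)=a(B(x,y))-(-1)^{|a||B|}B(a(x),y)-(-1)^{|a||B|+|x||y|}B(a(y),x)$ for $a\in\mathfrak{g}_0$, $B\in\mathfrak{g}_+$, $x,y\in\mathfrak{g}_-$. Koecher's construction: set $D_{x,y}=2L_{xy}+2[L_x,L_y]$, $\{x,y,z\}=D_{x,y}z$, and $\mathbb{D}_{x,u}=(D_{x,u},-(-1)^{|x||u|}D_{u,x})\in\mathrm{End}(V)\oplus\mathrm{End}(V)$. Let $\mathrm{Inn}(V,V)$ be the linear span of all $\mathbb{D}_{x,u}$. Then $\mathrm{Ko}(V)=V^+\oplus\mathrm{Inn}(V,V)\oplus V^-$, where $V^+$ and $V^-$ are two copies of $V$, with Lie superbracket (extended by super-antisymmetry), for $x,y\in V^+$, $u,v\in V^-$: $[x,u]=\mathbb{D}_{x,u}$, $[\mathbb{D}_{x,u},y]=\{x,u,y\}\in V^+$, $[\mathbb{D}_{x,u},v]=-(-1)^{|x||u|}\{u,x,v\}\in V^-$, $[x,y]=[u,v]=0$, and the componentwise supercommutator on $\mathrm{Inn}(V,V)$. *)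

(* Defs.v *)
From HB Require Import structures.
From mathcomp Require Import all_boot all_algebra all_classical.

Set Implicit Arguments.
Unset Strict Implicit.
Unset Printing Implicit Defensive.

Import GRing.Theory.

Local Open Scope classical_set_scope.
Local Open Scope ring_scope.

(* Parities, i.e. elements of Z/2Z, are booleans: 0 is false, 1 is true,
   addition is addb (+) and multiplication is andb &&.  Hence the sign
   (-1)^{ij} is (-1) ^+ (i && j). *)

Definition subspace (K : fieldType) (U : lmodType K) (A : set U) : Prop :=
  A 0 /\ forall (a : K) (u v : U), A u -> A v -> A (a *: u + v).

Definition span (K : fieldType) (U : lmodType K) (S : set U) : set U :=
  smallest (@subspace K U) S.

(* The direct sum decomposition V = V_0 (+) V_1 is given by its two
   projections; V_i is the range of the i-th one, see [homog]. *)
Record superspace (K : fieldType) := SuperSpace {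
  ss_sort :> lmodType K;
  pr : bool -> {linear ss_sort -> ss_sort};
  pr_pr : forall i j x, pr i (pr j x) = if i == j then pr j x else 0;
  pr_sum : forall x, pr false x + pr true x = x
}.

Section Superspace.
Variables (K : fieldType) (V : superspace K).

Definition homog (i : bool) : set V := [set x | pr V i x = x].

(* End(V) and End(V (x) V, V) are represented inside the vector spaces (with
   pointwise operations) of all functions V -> V and V -> V -> V.  Only linear,
   resp. bilinear, functions belong to the spaces [istr], [kan_pos] and [inn]
   below, as these are spanned by such functions. *)

Definition homog_end (i : bool) : set (V -> V) :=
  [set f | forall j x, homog j x -> homog (i (+) j) (f x)].

Definition homog_bil (i : bool) : set (V -> V -> V) :=
  [set B | forall j k x y, homog j x -> homog k y ->
     homog (i (+) j (+) k) (B x y)].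

(* For linear f, f = pr_end false f + pr_end true f is the decomposition of f
   into its homogeneous components; similarly for bilinear B. *)
Definition pr_end (i : bool) (f : V -> V) : V -> V :=
  fun x => \sum_(j : bool) pr V (i (+) j) (f (pr V j x)).

Definition pr_bil (i : bool) (B : V -> V -> V) : V -> V -> V :=
  fun x y => \sum_(j : bool) \sum_(k : bool)
    pr V (i (+) j (+) k) (B (pr V j x) (pr V k y)).

Definition pr_pair (i : bool) (T : (V -> V) * (V -> V)) : (V -> V) * (V -> V) :=
  (pr_end i T.1, pr_end i T.2).

Definition scomm (A B : V -> V) : V -> V :=
  \sum_(i : bool) \sum_(j : bool)
    ((pr_end i A \o pr_end j B)
     - (-1) ^+ (i && j) *: (pr_end j B \o pr_end i A)).

End Superspace.

(* If [u, w] = op u w, then super-antisymmetry forces, for homogeneous u and w,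
   [w, u] = - (-1)^{|u||w|} op u w; [sflip] is its bilinear extension, where
   prU and prW are the projections on homogeneous components. *)
Definition sflip (K : fieldType) (U W : Type) (T : lmodType K)
    (prU : bool -> U -> U) (prW : bool -> W -> W) (op : U -> W -> T)
    (w : W) (u : U) : T :=
  - \sum_(i : bool) \sum_(j : bool) (-1) ^+ (i && j) *: op (prU i u) (prW j w).

Record jordanSuperalgebra (K : fieldType) := JordanSuperalgebra {
  jordan_space :> superspace K;
  jmul : jordan_space -> jordan_space -> jordan_space;
  jmul_linearr : forall x, linear (jmul x);
  jmul_linearl : forall y, linear (jmul^~ y);
  jmul_homog : forall i j x y, homog i x -> homog j y ->
    homog (i (+) j) (jmul x y);
  jmulC : forall i j x y, homog i x -> homog j y ->
    jmul x y = (-1) ^+ (i && j) *: jmul y x;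
  jordan_identity : forall i j k x y z,
    homog i x -> homog j y -> homog k z ->
    (-1) ^+ (i && k) *: scomm (jmul x) (jmul (jmul y z))
    + (-1) ^+ (j && i) *: scomm (jmul y) (jmul (jmul z x))
    + (-1) ^+ (k && j) *: scomm (jmul z) (jmul (jmul x y)) = 0
}.

Definition unital (K : fieldType) (V : jordanSuperalgebra K) : Prop :=
  exists e : V, forall x : V, jmul e x = x /\ jmul x e = x.

(* Graded subspaces of a vector space, together with a bracket.  Nothing is
   assumed about [bracket] (not even that [carrier] is closed under it): this
   is the role of [is_lie_superalgebra].  The values of [bracket] outside
   [carrier] are irrelevant. *)
Record bracketSpace (K : fieldType) := BracketSpace {
  ambient : lmodType K;
  carrier : set ambient;
  part : bool -> set ambient;
  bracket : ambient -> ambient -> ambient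
}.
Arguments carrier {K} b.
Arguments part {K} b.

Record is_lie_superalgebra (K : fieldType) (g : bracketSpace K) : Prop :=
  IsLieSuperalgebra {
  lie_subspace : subspace (carrier g);
  lie_part_subspace : forall i, subspace (part g i);
  lie_part_sub : forall i, part g i `<=` carrier g;
  lie_part_sum : forall x, carrier g x ->
    exists y z, [/\ part g false y, part g true z & x = y + z];
  lie_part_direct : part g false `&` part g true `<=` [set 0];
  lie_linearl : forall a x y z, carrier g x -> carrier g y -> carrier g z ->
    bracket (a *: x + y) z = a *: bracket x z + bracket y z;
  lie_linearr : forall a x y z, carrier g x -> carrier g y -> carrier g z ->
    bracket z (a *: x + y) = a *: bracket z x + bracket z y;
  lie_part_bracket : forall i j x y, part g i x -> part g j y ->
    part g (i (+) j) (bracket x y);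
  lie_antisymmetry : forall i j x y, part g i x -> part g j y ->
    bracket x y = - ((-1) ^+ (i && j) *: bracket y x);
  lie_jacobi : forall i j k x y z, part g i x -> part g j y -> part g k z ->
    bracket x (bracket y z) =
    bracket (bracket x y) z + (-1) ^+ (i && j) *: bracket y (bracket x z)
}.

Definition bracket_isomorphism (K : fieldType) (g h : bracketSpace K)
    (f : ambient g -> ambient h) : Prop :=
  [/\ set_bij (carrier g) (carrier h) f,
      forall a x y, carrier g x -> carrier g y ->
        f (a *: x + y) = a *: f x + f y,
      forall i x, part g i x -> part h i (f x)
    & forall x y, carrier g x -> carrier g y ->
        f (bracket x y) = bracket (f x) (f y)].

Definition lie_superalgebra_isomorphic (K : fieldType) (g h : bracketSpace K) :
    Prop :=
  [/\ is_lie_superalgebra g, is_lie_superalgebra h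
    & exists f : ambient g -> ambient h, bracket_isomorphism f].

Section Kantor.
Variables (K : fieldType) (V : jordanSuperalgebra K).

(* [a, B] for a in g_0 and B in g_+ *)
Definition act_bil (a : V -> V) (B : V -> V -> V) : V -> V -> V :=
  fun x y => \sum_(i : bool) \sum_(j : bool) \sum_(k : bool) \sum_(l : bool)
    let ai := pr_end i a in let Bj := pr_bil j B in
    let xk := pr V k x in let yl := pr V l y in
    (ai (Bj xk yl)
     - (-1) ^+ (i && j) *: Bj (ai xk) yl
     - (-1) ^+ ((i && j) + (k && l)) *: Bj (ai yl) xk).

Definition istr : set (V -> V) :=
  span [set f | (exists a : V, f = jmul a)
             \/ (exists a b : V, f = scomm (jmul a) (jmul b))].

(* P is the product jmul itself. *)
Definition kan_pos : set (V -> V -> V) :=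
  span [set B | B = @jmul K V \/ (exists a : V, B = act_bil (jmul a) (@jmul K V))].

Definition kan_ambient : lmodType K := (V * (V -> V) * (V -> V -> V))%type.

Definition kan_carrier : set kan_ambient :=
  [set X | istr X.1.2 /\ kan_pos X.2].

Definition kan_part (i : bool) : set kan_ambient :=
  [set X | [/\ kan_carrier X, homog i X.1.1, homog_end i X.1.2
             & homog_bil i X.2]].

Definition kan_bracket (X Y : kan_ambient) : kan_ambient :=
  let: (x, a, A) := X in let: (y, b, B) := Y in
  let act (c : V -> V) (z : V) : V := c z in
  let ev (C : V -> V -> V) (z : V) : V -> V := C z in
  (act a y + sflip (@pr_end K V) (pr V) act x b,
   scomm a b + ev A y + sflip (@pr_bil K V) (pr V) ev x B,
   act_bil a B + sflip (@pr_end K V) (@pr_bil K V) act_bil A b).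

Definition Kan : bracketSpace K :=
  BracketSpace kan_carrier kan_part kan_bracket.

End Kantor.

Section Koecher.
Variables (K : fieldType) (V : jordanSuperalgebra K).

Definition koD (x y : V) : V -> V :=
  2%:R *: (jmul (jmul x y) : V -> V) + 2%:R *: scomm (jmul x) (jmul y).

Definition koDD (x u : V) : (V -> V) * (V -> V) :=
  (koD x u, sflip (pr V) (pr V) koD x u).

Definition inn : set ((V -> V) * (V -> V))%type :=
  span [set T | exists x u : V, T = koDD x u].

Definition ko_ambient : lmodType K :=
  (V * ((V -> V) * (V -> V)) * V)%type.

Definition ko_carrier : set ko_ambient := [set X | inn X.1.2].

Definition ko_part (i : bool) : set ko_ambient :=
  [set X | [/\ ko_carrier X, homog i X.1.1,
               homog_end i X.1.2.1 /\ homog_end i X.1.2.2 & homog i X.2]].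

(* For T = koDD x u with x, u homogeneous, T.1 y = {x, u, y} and
   T.2 v = - (-1)^{|x||u|} {u, x, v}: Inn(V, V) acts on V^+ by its first
   component and on V^- by its second one. *)
Definition ko_bracket (X Y : ko_ambient) : ko_ambient :=
  let: (x, T, u) := X in let: (y, T', v) := Y in
  let act1 (R : (V -> V) * (V -> V)) (z : V) : V := R.1 z in
  let act2 (R : (V -> V) * (V -> V)) (z : V) : V := R.2 z in
  (act1 T y + sflip (@pr_pair K V) (pr V) act1 x T',
   (scomm T.1 T'.1, scomm T.2 T'.2) + koDD x v + sflip (pr V) (pr V) koDD u y,
   act2 T v + sflip (@pr_pair K V) (pr V) act2 u T').

Definition Ko : bracketSpace K := BracketSpace ko_carrier ko_part ko_bracket.

End Koecher.

(* Main.v *)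
Require Import Defs.
From HB Require Import structures.
From mathcomp Require Import all_boot all_algebra all_classical.
From mathcomp Require Import ring.
Set Implicit Arguments.
Unset Strict Implicit.
Unset Printing Implicit Defensive.
Import GRing.Theory.
Local Open Scope classical_set_scope.
Local Open Scope ring_scope.

(** Let e be the unit of V.  Write L_a for the multiplication by a and
    A_w = [L_w, P] for w in V, where P is the product of V, so that
    A_w(x, y) = w(xy) - (wx)y - (-1)^{|w||x|} x(wy) for homogeneous elements.

    Since P = - A_e and A_w(e, e) = - w, the map w |-> A_w is a linear bijection
    from V onto g_+ ([kan_posP], [kanA_ee]).  An element a of g_0 = istr(V) is
    the sum of L_p, where p = a(e), and of a superderivation D = a - L_p of V
    ([istr_superder]); this comes from the fact that [L_b, L_c] is a
    superderivation ([inner_derivation]), itself a consequence of the Jordan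
    identity.  Put theta(a) = D - L_p = a - 2 L_{a(e)}.  Then theta preserves
    supercommutators ([theta_scomm]) and describes the action of g_0 on g_+:
    [a, A_w] = A_{theta(a) w} ([act_istr_kanA]).  Hence Kan(V) is V + g_0 + V
    where g_0 acts on the first copy of V naturally and on the second one
    through theta.

    On Koecher's side, Inn(V, V) is the set of pairs (a, theta(a)) with a in g_0
    ([innP]), and [x, u] in Ko(V), for x in V^+ and u in V^-, corresponds to
    [x, A_{2u}] in Kan(V) ([kanA_koD], [sflip_ev_koD]).  Therefore
      (x, a, A) |-> (x, (a, theta(a)), - A(e, e) / 2)
    is a bijection from Kan(V) to Ko(V) that respects brackets and parities
    ([kan_to_ko], [kan_to_ko_bracket]).

    It remains to see that one of the two is a Lie superalgebra.  For Kan(V) the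
    Jacobi identity ([kan_jacobi]) is formal except when two arguments are
    in g_+ and one in g_-, where it says that theta(A_v(z)) u is supersymmetric
    in u and v ([theta_kanA_sym]); the structure is then carried over to Ko(V)
    by [lie_transport].

    All identities are proved on homogeneous elements: the parities are
    enumerated, and what is left is an identity between linear combinations of
    vectors.  Bilinearity extends them to arbitrary elements ([bilin_ext]). *)

(** * A decision procedure for identities in modules *)

(** The trivial extension K + V of the field K by the vector space V, i.e. the
    commutative ring with V * V = 0.  It contains V, so that identities between
    linear combinations of vectors can be checked in a commutative ring. *)
Definition trivext (K : fieldType) (V : lmodType K) : Type := (K * V)%type.

Section TrivExt.
Variables (K : fieldType) (V : lmodType K).
Local Notation T := (trivext V).

HB.instance Definition _ := GRing.Zmodule.copy T (K * V)%type.

Definition te_mul (p q : T) : T := (p.1 * q.1, p.1 *: q.2 + q.1 *: p.2).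
Definition te_one : T := (1, 0).

Fact te_mulA : associative te_mul.
Proof.
move=> [a u] [b v] [c w]; rewrite /te_mul /= mulrA; congr pair.
by rewrite !scalerDr !scalerA -addrA [c * a]mulrC [c * b]mulrC.
Qed.

Fact te_mulC : commutative te_mul.
Proof. by move=> [a u] [b v]; rewrite /te_mul /= mulrC addrC. Qed.

Fact te_mul1 : left_id te_one te_mul.
Proof. by move=> [a u]; rewrite /te_mul /= mul1r scale1r scaler0 addr0. Qed.

Fact te_mulD : left_distributive te_mul +%R.
Proof.
move=> [a u] [b v] [c w]; rewrite /te_mul /=.
by apply: (@eq_trans _ _ (a * c + b * c, (a *: w + c *: u) + (b *: w + c *: v)));
  rewrite // mulrDl scalerDl scalerDr addrACA.
Qed.

Fact te_1_neq0 : te_one != 0.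
Proof. by apply/eqP => -[] /eqP; rewrite oner_eq0. Qed.

HB.instance Definition _ := GRing.Zmodule_isComNzRing.Build T
  te_mulA te_mulC te_mul1 te_mulD te_1_neq0.

(** The embeddings of V and K in the trivial extension. *)
Definition te_in (v : V) : T := (0, v).
Definition te_sc (a : K) : T := (a, 0).

Lemma te_in_inj u v : te_in u = te_in v -> u = v.
Proof. by case. Qed.

Lemma te_inD u v : te_in (u + v) = te_in u + te_in v.
Proof. by congr pair; rewrite addr0. Qed.

Lemma te_inN u : te_in (- u) = - te_in u.
Proof. by congr pair; rewrite oppr0. Qed.

Lemma te_in0 : te_in 0 = 0.
Proof. by []. Qed.

Lemma te_inZ a u : te_in (a *: u) = te_sc a * te_in u.
Proof. by congr pair; rewrite /= ?mulr0 // scale0r addr0. Qed.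

Fact te_sc_zmod : zmod_morphism te_sc.
Proof. by move=> a b; congr pair; rewrite subr0. Qed.

Fact te_sc_monoid : monoid_morphism te_sc.
Proof. by split=> // a b; congr pair; rewrite /= !scaler0 addr0. Qed.

HB.instance Definition _ := GRing.isZmodMorphism.Build K T te_sc te_sc_zmod.
HB.instance Definition _ := GRing.isMonoidMorphism.Build K T te_sc te_sc_monoid.

End TrivExt.

(** Proves an equality of linear combinations with scalar coefficients, the
    other subterms of module type being treated as indeterminates. *)
Ltac lmod_ring := apply: te_in_inj;
  rewrite ?(te_inD, te_inN, te_inZ, te_in0); ring.


(** Proves such an equality when the coefficients contain signs that depend on
    parities, by enumerating these parities. *)
Ltac koszul := clear;
  repeat match goal with b : bool |- _ => destruct b end;
  cbn [andb addb nat_of_bool]; lmod_ring.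

(** * Graded subspaces and bilinear maps *)

Section Graded.
Variable K : fieldType.

Section SubspaceFacts.
Variables (U : lmodType K) (C : set U).
Hypothesis hC : subspace C.

Lemma subspace0 : C 0.
Proof. by case: hC. Qed.

Lemma subspaceD u v : C u -> C v -> C (u + v).
Proof. by case: hC => _ h cu cv; rewrite -[u]scale1r; apply: h. Qed.

Lemma subspaceZ a u : C u -> C (a *: u).
Proof. by case: hC => h0 h cu; rewrite -[X in C X]addr0; apply: h. Qed.

Lemma subspaceN u : C u -> C (- u).
Proof. by rewrite -scaleN1r; apply: subspaceZ. Qed.

Lemma subspaceB u v : C u -> C v -> C (u - v).
Proof. by move=> cu cv; apply/subspaceD/subspaceN. Qed.

End SubspaceFacts.

Lemma span_subspace (U : lmodType K) (S : set U) : subspace (Defs.span S).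
Proof.
split=> [A [[]]//|a u v hu hv A hA].
by case: (hA) => -[_ h] _; apply: h; [apply: hu | apply: hv].
Qed.

Lemma span_gen (U : lmodType K) (S : set U) u : S u -> Defs.span S u.
Proof. by move=> hu A [_]; apply. Qed.

Lemma span_ind (U : lmodType K) (S Q : set U) :
  subspace Q -> S `<=` Q -> Defs.span S `<=` Q.
Proof. by move=> hQ hS u; apply; split. Qed.

(** [graded C H p]: the subspace C is the direct sum of its even and odd parts,
    the part of parity i being its intersection with H i, and the map p i
    restricts to the projection of C on this part. *)
Record graded (U : lmodType K) (C : set U) (H : bool -> set U)
    (p : bool -> U -> U) : Prop := Graded {
  gr_subspace : subspace C;
  gr_part_subspace : forall i, subspace (H i);
  gr_closed : forall i u, C u -> C (p i u);
  gr_linear : forall i a u v, C u -> C v ->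
    p i (a *: u + v) = a *: p i u + p i v;
  gr_part : forall i u, C u -> H i (p i u);
  gr_id : forall i u, C u -> H i u -> p i u = u;
  gr_neg : forall i u, C u -> H i u -> p (~~ i) u = 0;
  gr_sum : forall u, C u -> u = p false u + p true u
}.

Lemma graded_sub (U : lmodType K) (C C' : set U) H p :
  graded C H p -> subspace C' -> C' `<=` C ->
  (forall i u, C' u -> C' (p i u)) -> graded C' H p.
Proof.
move=> g sC' CC' pC'; split=> //.
- exact: gr_part_subspace g.
- by move=> i a u v /CC' cu /CC' cv; apply: (gr_linear g).
- by move=> i u /CC'; apply: (gr_part g).
- by move=> i u /CC'; apply: (gr_id g).
- by move=> i u /CC'; apply: (gr_neg g).
- by move=> u /CC'; apply: (gr_sum g).
Qed.

Lemma graded_direct (U : lmodType K) (C : set U) H p u :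
  graded C H p -> C u -> H false u -> H true u -> u = 0.
Proof.
by move=> g cu h0 h1; have := gr_neg g cu h1; rewrite (gr_id g cu h0).
Qed.

(** Even linear maps commute with the projections on homogeneous components. *)
Lemma graded_morph (U W : lmodType K) (C : set U) (D : set W)
    H p H' p' (f : U -> W) i u :
  graded C H p -> graded D H' p' ->
  (forall x y, C x -> C y -> f (x + y) = f x + f y) ->
  (forall x, C x -> D (f x)) ->
  (forall j x, C x -> H j x -> H' j (f x)) ->
  C u -> p' i (f u) = f (p i u).
Proof.
move=> gC gD fD fC fH cu.
have cp j : C (p j u) by apply: (gr_closed gC).
have hp j : H' j (f (p j u)) by apply: fH => //; apply: (gr_part gC).
have := gr_linear gD i 1 (fC _ (cp false)) (fC _ (cp true)).
rewrite !scale1r -fD // -(gr_sum gC cu) => ->.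
have E j := gr_id gD (fC _ (cp j)) (hp j).
have N j := gr_neg gD (fC _ (cp j)) (hp j).
by case: i; rewrite E ?(N true) ?(N false) ?addr0 ?add0r.
Qed.

(** [op] is bilinear on C x D; nothing is asked outside these subspaces. *)
Definition bilin (U W T : lmodType K) (C : set U) (D : set W)
    (op : U -> W -> T) : Prop :=
  (forall a u v w, C u -> C v -> D w ->
     op (a *: u + v) w = a *: op u w + op v w)
  /\ (forall a u w z, C u -> D w -> D z ->
     op u (a *: w + z) = a *: op u w + op u z).

Section Bilin.
Variables (U W T : lmodType K) (C : set U) (D : set W) (op : U -> W -> T).
Hypotheses (sC : subspace C) (sD : subspace D) (hop : bilin C D op).

Lemma bilin0l w : D w -> op 0 w = 0.
Proof.
move=> dw; case: hop => h _; have c0 := subspace0 sC.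
have := h 1 0 0 w c0 c0 dw; rewrite scaler0 addr0 scale1r => e.
by apply: (@addrI _ (op 0 w)); rewrite addr0 -e.
Qed.

Lemma bilin0r u : C u -> op u 0 = 0.
Proof.
move=> cu; case: hop => _ h; have d0 := subspace0 sD.
have := h 1 u 0 0 cu d0 d0; rewrite scaler0 addr0 scale1r => e.
by apply: (@addrI _ (op u 0)); rewrite addr0 -e.
Qed.

Lemma bilinDl u v w : C u -> C v -> D w -> op (u + v) w = op u w + op v w.
Proof.
by move=> cu cv dw; case: hop => h _; have := h 1 u v w cu cv dw;
  rewrite !scale1r.
Qed.

Lemma bilinDr u w z : C u -> D w -> D z -> op u (w + z) = op u w + op u z.
Proof.
by move=> cu dw dz; case: hop => _ h; have := h 1 u w z cu dw dz;
  rewrite !scale1r.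
Qed.

Lemma bilinZl a u w : C u -> D w -> op (a *: u) w = a *: op u w.
Proof.
move=> cu dw; case: hop => h _.
by have := h a u 0 w cu (subspace0 sC) dw; rewrite !addr0 bilin0l // addr0.
Qed.

Lemma bilinZr a u w : C u -> D w -> op u (a *: w) = a *: op u w.
Proof.
move=> cu dw; case: hop => _ h.
by have := h a u w 0 cu dw (subspace0 sD); rewrite !addr0 bilin0r // addr0.
Qed.

Lemma bilinBl u v w : C u -> C v -> D w -> op (u - v) w = op u w - op v w.
Proof.
move=> cu cv dw.
by rewrite -scaleN1r bilinDl ?bilinZl ?scaleN1r //; apply: (subspaceN sC).
Qed.

Lemma bilinBr u w z : C u -> D w -> D z -> op u (w - z) = op u w - op u z.
Proof.
move=> cu dw dz.
by rewrite -scaleN1r bilinDr ?bilinZr ?scaleN1r //; apply: (subspaceN sD).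
Qed.

End Bilin.

(** Bilinear maps on graded subspaces are determined by their values on
    homogeneous elements. *)
Lemma bilin_ext (U W T : lmodType K) (C : set U) (D : set W) H p H' p'
    (op op' : U -> W -> T) :
  graded C H p -> graded D H' p' -> bilin C D op -> bilin C D op' ->
  (forall i j u w, C u -> H i u -> D w -> H' j w -> op u w = op' u w) ->
  forall u w, C u -> D w -> op u w = op' u w.
Proof.
move=> gC gD hop hop' e u w cu dw.
have sC := gr_subspace gC; have sD := gr_subspace gD.
have pC i : C (p i u) by exact: (gr_closed gC i cu).
have pD i : D (p' i w) by exact: (gr_closed gD i dw).
rewrite (gr_sum gC cu) (gr_sum gD dw).
have cs : C (p false u + p true u) by apply: (subspaceD sC).
have ds : D (p' false w + p' true w) by apply: (subspaceD sD).
rewrite !(bilinDl hop) ?(bilinDl hop') // !(bilinDr hop) ?(bilinDr hop') //.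
congr (_ + _ + (_ + _)); apply: e => //;
  by [apply: (gr_part gC) | apply: (gr_part gD)].
Qed.

Section Sflip.
Variables (U W T : lmodType K) (C : set U) (D : set W).
Variables (H : bool -> set U) (p : bool -> U -> U).
Variables (H' : bool -> set W) (p' : bool -> W -> W).
Variable op : U -> W -> T.
Hypotheses (gC : graded C H p) (gD : graded D H' p') (hop : bilin C D op).

Lemma sflip_bilin : bilin D C (sflip p p' op).
Proof.
have pC i u : C u -> C (p i u) by exact: (gr_closed gC).
have pD i u : D u -> D (p' i u) by exact: (gr_closed gD).
rewrite /bilin /sflip; split=> [a u v w du dv cw|a u w z du cw cz].
- rewrite !big_bool !(gr_linear gD) //; case: hop => _ h.
  by rewrite !h; auto; lmod_ring.
- rewrite !big_bool !(gr_linear gC) //; case: hop => h _.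
  by rewrite !h; auto; lmod_ring.
Qed.

Lemma sflipE i j u w : C u -> H i u -> D w -> H' j w ->
  sflip p p' op w u = - ((-1) ^+ (i && j) *: op u w).
Proof.
move=> cu hu dw hw; rewrite /sflip !big_bool.
have sC := gr_subspace gC; have sD := gr_subspace gD.
have := gr_id gC cu hu; have := gr_neg gC cu hu.
have := gr_id gD dw hw; have := gr_neg gD dw hw.
by case: i {hu}; case: j {hw} => /= -> -> -> ->;
  rewrite ?(bilin0l sC hop) ?(bilin0r sD hop) ?scaler0 ?add0r ?addr0 //;
  by [apply: subspace0 sC | apply: subspace0 sD].
Qed.

End Sflip.
End Graded.

(** * Operators on a super vector space *)

Section Super.
Variables (K : fieldType) (V : superspace K).

(** The spaces of linear and of bilinear maps, among all functions. *)
Definition lin : set (V -> V) := [set f | linear f].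

Definition bil : set (V -> V -> V) :=
  [set B | (forall x, linear (B x)) /\ (forall y, linear (B^~ y))].

Section Linear.
Variable f : V -> V.
Hypothesis hf : linear f.

Lemma linD x y : f (x + y) = f x + f y.
Proof. by have := hf 1 x y; rewrite !scale1r. Qed.

Lemma lin0 : f 0 = 0.
Proof. by apply: (@addrI _ (f 0)); rewrite -linD !addr0. Qed.

Lemma linZ a x : f (a *: x) = a *: f x.
Proof. by have := hf a x 0; rewrite !addr0 lin0 addr0. Qed.

Lemma linN x : f (- x) = - f x.
Proof. by rewrite -scaleN1r linZ scaleN1r. Qed.

Definition linE := (linD, linN, linZ, lin0).

End Linear.

Lemma homog_pr i (x : V) : homog i (pr V i x).
Proof. by rewrite /homog /= pr_pr eqxx. Qed.

Lemma homog_subspace i : subspace (@homog K V i).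
Proof.
by split=> [|a u v hu hv]; rewrite /homog /= ?linear0 // linearP hu hv.
Qed.

Lemma homog_pr_neg i (x : V) : homog i x -> pr V (~~ i) x = 0.
Proof. by move=> <-; rewrite pr_pr; case: i. Qed.

Lemma homogD i (x y : V) : homog i x -> homog i y -> homog i (x + y).
Proof. exact: (subspaceD (homog_subspace i)). Qed.

Lemma homogN i (x : V) : homog i x -> homog i (- x).
Proof. exact: (subspaceN (homog_subspace i)). Qed.

Lemma homogZ i a (x : V) : homog i x -> homog i (a *: x).
Proof. exact: (subspaceZ (homog_subspace i)). Qed.

Lemma graded_space : graded setT (@homog K V) (pr V).
Proof.
split=> //.
- exact: homog_subspace.
- by move=> i a u v _ _; rewrite linearP.
- by move=> i u _; apply: homog_pr.
- by move=> i u _; apply: homog_pr_neg.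
- by move=> u _; rewrite pr_sum.
Qed.

Lemma lin_ext (f g : V -> V) : linear f -> linear g ->
  (forall i x, homog i x -> f x = g x) -> f = g.
Proof.
move=> hf hg e; apply: funext => x; rewrite -(pr_sum x) !linD //.
by rewrite !(e _ _ (homog_pr _ _)).
Qed.

Lemma bil_ext (B C : V -> V -> V) : bil B -> bil C ->
  (forall i j x y, homog i x -> homog j y -> B x y = C x y) -> B = C.
Proof.
move=> hB hC e; apply: funext => x; apply: lin_ext; [exact: hB.1|exact: hC.1|].
move=> j y hy; rewrite -(pr_sum x) (linD (hB.2 y)) (linD (hC.2 y)).
by rewrite !(e _ _ _ _ (homog_pr _ _) hy).
Qed.

Lemma lin_subspace : subspace lin.
Proof.
split=> [a x y|a f g hf hg b x y]; first by rewrite scaler0 addr0.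
by rewrite !fctE hf hg; lmod_ring.
Qed.

Lemma bil_subspace : subspace bil.
Proof.
split=> [|a B C [hB hB'] [hC hC']].
  by split=> z a x y; rewrite scaler0 addr0.
by split=> z b x y; rewrite !fctE ?hB ?hC ?hB' ?hC'; lmod_ring.
Qed.

Lemma homog_end_subspace i : subspace (@homog_end K V i).
Proof.
split=> [j x _|a f g hf hg j x hx]; first exact: subspace0 (homog_subspace _).
by apply: homogD; [apply/homogZ/hf | apply: hg].
Qed.

Lemma homog_bil_subspace i : subspace (@homog_bil K V i).
Proof.
split=> [j k x y _ _|a B C hB hC j k x y hx hy].
  exact: subspace0 (homog_subspace _).
by apply: homogD; [apply/homogZ/hB | apply: hC].
Qed.

Lemma pr_end_lin i (f : V -> V) : lin f -> lin (pr_end i f).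
Proof.
move=> hf a x y; rewrite /pr_end !big_bool !linearP !hf !linearP; lmod_ring.
Qed.

Lemma pr_bil_bil i (B : V -> V -> V) : bil B -> bil (pr_bil i B).
Proof.
move=> [h h']; split=> z a x y; rewrite /pr_bil !big_bool !linearP.
  by rewrite !h !linearP; lmod_ring.
by rewrite !h' !linearP; lmod_ring.
Qed.

Lemma graded_end : graded lin (@homog_end K V) (@pr_end K V).
Proof.
have E i j f (x : V) : homog j x -> pr_end i (f : V -> V) x =
    pr V (i (+) j) (f x) + pr V (i (+) ~~ j) (f 0).
  rewrite /pr_end big_bool => hx; have := homog_pr_neg hx; have := hx.
  by rewrite /homog /=; case: j {hx} => /= -> ->; rewrite // addrC.
split.
- exact: lin_subspace.
- exact: homog_end_subspace.
- exact: pr_end_lin.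
- move=> i a f g hf hg; apply: funext => x.
  by rewrite /pr_end !fctE !big_bool /= ?fctE !linearP; lmod_ring.
- by move=> i f hf j x hx; rewrite (E _ j) // (lin0 hf) linear0 addr0;
    apply: homog_pr.
- move=> i f hf hi; apply: lin_ext => [||j x hx]; rewrite //.
    exact: pr_end_lin.
  by rewrite (E _ j) // (lin0 hf) linear0 addr0; apply: hi.
- move=> i f hf hi; apply: lin_ext => [||j x hx].
  + exact: pr_end_lin.
  + exact: (subspace0 lin_subspace).
  + rewrite (E _ j) // (lin0 hf) linear0 addr0 addNb.
    by apply: homog_pr_neg; apply: hi.
- move=> f hf; apply: lin_ext => [||j x hx]; rewrite //.
    by apply: (subspaceD lin_subspace); apply: pr_end_lin.
  rewrite !fctE !(E _ j) // (lin0 hf) !linear0 !addr0 -[LHS]pr_sum.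
  by case: (j); rewrite // addrC.
Qed.

Lemma graded_bil : graded bil (@homog_bil K V) (@pr_bil K V).
Proof.
have E i j k (B : V -> V -> V) x y : bil B -> homog j x -> homog k y ->
    pr_bil i B x y = pr V (i (+) j (+) k) (B x y).
  rewrite /pr_bil !big_bool => hB hx hy.
  have := homog_pr_neg hx; have := homog_pr_neg hy; have := hx; have := hy.
  rewrite /homog /=; case: j {hx}; case: k {hy} => /= -> -> -> ->;
  by rewrite ?(lin0 (hB.1 _)) ?(lin0 (hB.2 _)) ?linear0 ?addr0 ?add0r.
split.
- exact: bil_subspace.
- exact: homog_bil_subspace.
- exact: pr_bil_bil.
- move=> i a f g hf hg; apply: funext => x; apply: funext => y.
  by rewrite /pr_bil !fctE !big_bool /= ?fctE !linearP; lmod_ring.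
- by move=> i B hB j k x y hx hy; rewrite (E _ j k) //; apply: homog_pr.
- move=> i B hB hi; apply: bil_ext => [||j k x y hx hy]; rewrite //.
    exact: pr_bil_bil.
  by rewrite (E _ j k) //; apply: hi.
- move=> i B hB hi; apply: bil_ext => [||j k x y hx hy].
  + exact: pr_bil_bil.
  + exact: (subspace0 bil_subspace).
  + by rewrite (E _ j k) // !addNb; apply: homog_pr_neg; apply: hi.
- move=> B hB; apply: bil_ext => [||j k x y hx hy]; rewrite //.
    by apply: (subspaceD bil_subspace); apply: pr_bil_bil.
  rewrite !fctE !(E _ j k) // -[LHS]pr_sum.
  by case: (j); case: (k); rewrite // addrC.
Qed.

Lemma pr_end_id i (f : V -> V) : lin f -> homog_end i f -> pr_end i f = f.
Proof. exact: (gr_id graded_end). Qed.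

Lemma pr_end_neg i (f : V -> V) : lin f -> homog_end i f -> pr_end (~~ i) f = 0.
Proof. exact: (gr_neg graded_end). Qed.

Lemma pr_bil_id i (B : V -> V -> V) : bil B -> homog_bil i B -> pr_bil i B = B.
Proof. exact: (gr_id graded_bil). Qed.

Lemma pr_bil_neg i (B : V -> V -> V) :
  bil B -> homog_bil i B -> pr_bil (~~ i) B = 0.
Proof. exact: (gr_neg graded_bil). Qed.

Lemma lin_comp (f g : V -> V) : lin f -> lin g -> lin (f \o g).
Proof. by move=> hf hg a x y; rewrite /= hg hf. Qed.

Lemma scomm_lin (f g : V -> V) : lin f -> lin g -> lin (scomm f g).
Proof.
move=> hf hg; have pl i := pr_end_lin i hf; have pg i := pr_end_lin i hg.
rewrite /scomm !big_bool; do ! apply: (subspaceD lin_subspace);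
by [apply: lin_comp
   |apply/(subspaceN lin_subspace)/(subspaceZ lin_subspace)/lin_comp].
Qed.

Lemma scomm_bilin : bilin lin lin (@scomm K V).
Proof.
split=> a f g h hf hg hh; apply: funext => x; rewrite /scomm !big_bool
  !(gr_linear graded_end) // !fctE /= !fctE
  !(linE (pr_end_lin _ hf), linE (pr_end_lin _ hh)); lmod_ring.
Qed.

Lemma scommE i j (f g : V -> V) :
  lin f -> homog_end i f -> lin g -> homog_end j g ->
  scomm f g = (f \o g) - (-1) ^+ (i && j) *: (g \o f).
Proof.
move=> hf hi hg hj; apply: funext => x; rewrite /scomm !big_bool !fctE /=.
have := pr_end_id hf hi; have := pr_end_neg hf hi.
have := pr_end_id hg hj; have := pr_end_neg hg hj.
have z (y : V) : (0 : V -> V) y = 0 by [].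
case: i {hi}; case: j {hj} => /= -> -> -> ->;
  rewrite ?fctE /= ?z ?(lin0 hf) ?(lin0 hg) ?z; lmod_ring.
Qed.

Lemma scomm_homog i j (f g : V -> V) :
  lin f -> homog_end i f -> lin g -> homog_end j g ->
  homog_end (i (+) j) (scomm f g).
Proof.
move=> hf hi hg hj k x hx; rewrite (scommE hf hi hg hj).
apply: homogD; first by rewrite -addbA; apply/hi/hj.
by apply/homogN/homogZ; rewrite /= [i (+) j]addbC -addbA; apply/hj/hi.
Qed.

End Super.

Section ActBil.
Variables (K : fieldType) (V : jordanSuperalgebra K).

Lemma act_bilE i j k l (a : V -> V) (B : V -> V -> V) x y :
  @lin K V a -> homog_end i a ->
  @bil K V B -> homog_bil j B -> homog k x -> homog l y ->
  act_bil a B x y = a (B x y) - (-1) ^+ (i && j) *: B (a x) y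
                    - (-1) ^+ ((i && j) + (k && l)) *: B (a y) x.
Proof.
move=> la ha bB hB hx hy; rewrite /act_bil.
have ne (m n : bool) : m != n -> m = ~~ n by case: m; case: n.
have z (u : V) : (0 : V -> V) u = 0 by [].
have z' (u v : V) : (0 : V -> V -> V) u v = 0 by [].
have a0 := lin0 la; have B0 u := lin0 (bB.1 u).
have B0' u : B 0 u = 0 := lin0 (bB.2 u).
rewrite (bigD1 i) //= [X in _ + X]big1 ?addr0; last first.
  move=> m /ne ->; rewrite big1 // => n _; rewrite big1 // => r _.
  rewrite big1 // => s _; have [h h'] := pr_bil_bil n bB.
  rewrite (pr_end_neg la ha) !z (lin0 (h' _)) (lin0 (h' _)).
  by rewrite !scaler0 !subr0.
rewrite (pr_end_id la ha) (bigD1 j) //= [X in _ + X]big1 ?addr0; last first.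
  move=> m /ne ->; rewrite big1 // => n _; rewrite big1 // => r _.
  by rewrite (pr_bil_neg bB hB) !z' a0 !scaler0 !subr0.
rewrite (pr_bil_id bB hB) (bigD1 k) //= [X in _ + X]big1 ?addr0; last first.
  move=> m /ne ->; rewrite big1 // => n _.
  by rewrite (homog_pr_neg hx) !(a0, B0, B0') !scaler0 !subr0.
rewrite (bigD1 l) //= [X in _ + X]big1 ?addr0; last first.
  by move=> m /ne ->; rewrite (homog_pr_neg hy) !(a0, B0, B0') !scaler0 !subr0.
by move: (hx) (hy); rewrite /homog /= => -> ->.
Qed.

Lemma act_bil_bil (a : V -> V) (B : V -> V -> V) :
  @lin K V a -> @bil K V B -> @bil K V (act_bil a B).
Proof.
move=> la bB; have pa i := pr_end_lin i la; have [pb pb'] :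
  (forall i x, linear (pr_bil i B x)) /\ (forall i x, linear (pr_bil i B ^~ x)).
  by split=> i; case: (pr_bil_bil i bB).
have pb'' i a' x y z : pr_bil i B (a' *: x + y) z =
   a' *: pr_bil i B x z + pr_bil i B y z by exact: pb'.
split=> z b x y; rewrite /act_bil;
do 4!(rewrite scaler_sumr -big_split; apply: eq_bigr => ? _ /=);
rewrite !linearP ?pb ?pb'' ?pa ?pb ?pb''; lmod_ring.
Qed.

Lemma act_bil_bilin : bilin (@lin K V) (@bil K V) (@act_bil K V).
Proof.
split=> a u v w hu hv hw; apply: funext => x; apply: funext => y;
rewrite !fctE /act_bil;
do 4!(rewrite scaler_sumr -big_split; apply: eq_bigr => ? _ /=).
- have pb'' i a' x' y' z : pr_bil i w (a' *: x' + y') z =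
   a' *: pr_bil i w x' z + pr_bil i w y' z by case: (pr_bil_bil i hw) => _; apply.
  by rewrite !(gr_linear (@graded_end K V)) // !fctE !pb''; lmod_ring.
- have pa i := pr_end_lin i hu.
  by rewrite !(gr_linear (@graded_bil K V)) // !fctE !pa; lmod_ring.
Qed.

Lemma act_bil_homog i j (a : V -> V) (B : V -> V -> V) :
  @lin K V a -> homog_end i a ->
  @bil K V B -> homog_bil j B -> homog_bil (i (+) j) (act_bil a B).
Proof.
move=> la ha bB hB k l x y hx hy; rewrite (act_bilE la ha bB hB hx hy).
apply: homogD; first apply: homogD; last 2 first.
- apply/homogN/homogZ.
  have -> : i (+) j (+) k (+) l = j (+) (i (+) k) (+) l.
    by rewrite !addbA [j (+) i]addbC.
  by apply: hB => //; apply: ha.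
- apply/homogN/homogZ.
  have -> : i (+) j (+) k (+) l = j (+) (i (+) l) (+) k.
    by rewrite !addbA [j (+) i]addbC -!addbA [k (+) l]addbC.
  by apply: hB => //; apply: ha.
have -> : i (+) j (+) k (+) l = i (+) (j (+) k (+) l) by rewrite !addbA.
by apply: ha; apply: hB.
Qed.

End ActBil.

(** * Consequences of the Jordan identity *)

Lemma lincomb2 (K : fieldType) (U : lmodType K) (a b : K) (e1 e2 g : U) :
  e1 = 0 -> e2 = 0 -> g = a *: e1 + b *: e2 -> g = 0.
Proof. by move=> -> -> ->; rewrite !scaler0 addr0. Qed.

Section Jordan.
Variables (K : fieldType) (V : jordanSuperalgebra K).
Implicit Types x y z w u v : V.

Local Notation "x *j y" := (@jmul K V x y) (at level 40, left associativity).

Lemma mul_lin x : lin (@jmul K V x).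
Proof. exact: jmul_linearr. Qed.

Lemma mul_bil : bil (@jmul K V).
Proof. by split; [exact: jmul_linearr | exact: jmul_linearl]. Qed.

Lemma jmulDr x y z : x *j (y + z) = x *j y + x *j z.
Proof. by rewrite (linD (mul_lin x)). Qed.

Lemma jmulNr x y : x *j (- y) = - (x *j y).
Proof. by rewrite (linN (mul_lin x)). Qed.

Lemma jmulZr a x y : x *j (a *: y) = a *: (x *j y).
Proof. by rewrite (linZ (mul_lin x)). Qed.

Lemma jmul0r x : x *j 0 = 0.
Proof. by rewrite (lin0 (mul_lin x)). Qed.

Lemma jmulDl x y z : (y + z) *j x = y *j x + z *j x.
Proof. by rewrite (linD (jmul_linearl x)). Qed.

Lemma jmulNl x y : (- y) *j x = - (y *j x).
Proof. by rewrite (linN (jmul_linearl x)). Qed.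

Lemma jmulZl a x y : (a *: y) *j x = a *: (y *j x).
Proof. by rewrite (linZ (jmul_linearl x)). Qed.

Lemma jmul0l x : 0 *j x = 0.
Proof. by rewrite (lin0 (jmul_linearl x)). Qed.

Definition jmulE :=
  (jmulDr, jmulNr, jmulZr, jmul0r, jmulDl, jmulNl, jmulZl, jmul0l).

Lemma mul_homog i x : homog i x -> homog_end i (jmul x).
Proof. by move=> hx j y hy; apply: jmul_homog. Qed.

Lemma mul_homog_bil : homog_bil false (@jmul K V).
Proof. by move=> j k x y hx hy; apply: jmul_homog. Qed.

(** The Jordan identity applied to an element w.  The sign of each term is that
    of the permutation of the odd letters among x, y, z, w in it. *)
Lemma jordan_koszul i j k l x y z w :
  homog i x -> homog j y -> homog k z -> homog l w ->
  x *j (y *j z *j w) - (-1) ^+ (i && (j (+) k)) *: ((y *j z) *j (x *j w))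
  + (-1) ^+ (i && j) *: (y *j (x *j z *j w))
  - (-1) ^+ (j && k) *: ((x *j z) *j (y *j w))
  + (-1) ^+ ((i (+) j) && k) *: (z *j (x *j y *j w))
  - (x *j y) *j (z *j w) = 0.
Proof.
move=> hx hy hz hw; have := jordan_identity hx hy hz.
move/(congr1 (fun f : V -> V => f w)); rewrite [z *j x](jmulC hz hx).
have hyz := jmul_homog hy hz; have hxy := jmul_homog hx hy.
have hxz := jmul_homog hx hz.
have -> : jmul ((-1) ^+ (k && i) *: (x *j z)) =
          (-1) ^+ (k && i) *: (jmul (x *j z) : V -> V).
  by apply: funext => u; rewrite jmulZl.
rewrite (bilinZr (@lin_subspace K V) (@scomm_bilin K V)); try exact: mul_lin.
rewrite (scommE (mul_lin x) (mul_homog hx) (mul_lin _) (mul_homog hyz)).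
rewrite (scommE (mul_lin y) (mul_homog hy) (mul_lin _) (mul_homog hxz)).
rewrite (scommE (mul_lin z) (mul_homog hz) (mul_lin _) (mul_homog hxy)).
rewrite !fctE /= => h; apply: (lincomb2 (a := (-1) ^+ (i && k)) (b := 0) h h).
by koszul.
Qed.

(** The supercommutator D of L_x and L_z satisfies
    D(yw) = D(y)w + (-1)^{|D||y|} y D(w).  The terms (xy)(zw) +
    (xz)(yw) + (yz)(xw) of the Jordan identity are supersymmetric in its four
    variables, so that they cancel in the difference of the identities for
    (x, y, w; z) and (z, y, w; x). *)
Lemma inner_derivation i j k l x z y w :
  homog i x -> homog j z -> homog k y -> homog l w ->
  x *j (z *j (y *j w)) - (-1) ^+ (i && j) *: (z *j (x *j (y *j w)))
  = (x *j (z *j y) - (-1) ^+ (i && j) *: (z *j (x *j y))) *j w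
    + (-1) ^+ ((i (+) j) && k) *:
        (y *j (x *j (z *j w) - (-1) ^+ (i && j) *: (z *j (x *j w)))).
Proof.
move=> hx hz hy hw; apply/eqP; rewrite -subr_eq0; apply/eqP.
have m := @jmul_homog K V; have c := @jmulC K V.
have h1 := jordan_koszul hx hy hw hz; have h2 := jordan_koszul hz hy hw hx.
rewrite (c _ _ _ _ (m _ _ _ _ hy hw) hz) (c _ _ _ _ (m _ _ _ _ hx hw) hz)
  (c _ _ _ _ hw (m _ _ _ _ (m _ _ _ _ hx hy) hz))
  (c _ _ _ _ (m _ _ _ _ hx hy) hz) (c _ _ _ _ hw hz) (c _ _ _ _ hy hz)
  !jmulE (c _ _ _ _ (m _ _ _ _ hx hy) (m _ _ _ _ hz hw))
  (c _ _ _ _ (m _ _ _ _ hx hw) (m _ _ _ _ hz hy)) in h1.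
rewrite (c _ _ _ _ (m _ _ _ _ hy hw) hx) (c _ _ _ _ (m _ _ _ _ hz hw) hx)
  (c _ _ _ _ hw (m _ _ _ _ (m _ _ _ _ hz hy) hx))
  (c _ _ _ _ (m _ _ _ _ hz hy) hx) (c _ _ _ _ hw hx) (c _ _ _ _ hy hx)
  (c _ _ _ _ hz hx) !jmulE in h2.
(* the signs relate the orders xywz and zywx of the letters to xzyw *)
apply: (lincomb2 (a := (-1) ^+ ((k (+) l) && j))
  (b := - (-1) ^+ (i && (j (+) k (+) l))) h1 h2).
rewrite !jmulE.
by koszul.
Qed.

End Jordan.

(** * The spaces g_0 and g_+ *)

Section Structure.
Variables (K : fieldType) (V : jordanSuperalgebra K).
Implicit Types x y z w u v : V.

Local Notation "x *j y" := (@jmul K V x y) (at level 40, left associativity).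
Local Notation L := (@jmul K V).
Local Notation linV := (@lin K V).
Local Notation bilV := (@bil K V).

(** Supersymmetric maps. *)
Definition supersym (B : V -> V -> V) : Prop :=
  forall k l x y, homog k x -> homog l y ->
    B x y = (-1) ^+ (k && l) *: B y x.

(** On a supersymmetric map B, the action is the usual one:
    [a, B](x, y) = a(B(x, y)) - B(a(x), y) - B(x, a(y)), up to signs. *)
Lemma act_bil_sym i j k l (a : V -> V) (B : V -> V -> V) x y :
  linV a -> homog_end i a -> bilV B -> homog_bil j B -> supersym B ->
  homog k x -> homog l y ->
  act_bil a B x y = a (B x y) - (-1) ^+ (i && j) *: B (a x) y
                    - (-1) ^+ (i && (j (+) k)) *: B x (a y).
Proof.
move=> la ha bB hB sB hx hy; rewrite (act_bilE la ha bB hB hx hy).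
rewrite (sB _ _ _ _ (ha _ _ hy) hx).
by koszul.
Qed.

(** The element [L_u, P] of g_+. *)
Definition kanA u : V -> V -> V := act_bil (L u) L.

Lemma kanA_bil u : bilV (kanA u).
Proof. by apply: act_bil_bil; [apply: mul_lin | apply: mul_bil]. Qed.

Lemma kanAP a u v : kanA (a *: u + v) = a *: kanA u + kanA v.
Proof.
rewrite /kanA.
have -> : L (a *: u + v) = a *: (L u : V -> V) + L v.
  by apply: funext => x; rewrite !fctE !jmulE.
by case: (@act_bil_bilin K V) => -> //; do ?[exact: mul_lin | exact: mul_bil].
Qed.

Lemma kanAD u v : kanA (u + v) = kanA u + kanA v.
Proof. by have := kanAP 1 u v; rewrite !scale1r. Qed.

Lemma kanA0 : kanA 0 = 0.
Proof. by apply: (@addrI _ (kanA 0)); rewrite -kanAD !addr0. Qed.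

Lemma kanAZ a u : kanA (a *: u) = a *: kanA u.
Proof. by have := kanAP a u 0; rewrite !addr0 kanA0 addr0. Qed.

Lemma kanAN u : kanA (- u) = - kanA u.
Proof. by rewrite -scaleN1r kanAZ scaleN1r. Qed.

Lemma kanA_homog i u : homog i u -> homog_bil i (kanA u).
Proof.
move=> hu; rewrite -[i]addbF; apply: act_bil_homog.
- exact: mul_lin.
- exact: mul_homog.
- exact: mul_bil.
- exact: mul_homog_bil.
Qed.

Lemma kanAE i k l u x y : homog i u -> homog k x -> homog l y ->
  kanA u x y = u *j (x *j y) - (u *j x) *j y
               - (-1) ^+ (i && k) *: (x *j (u *j y)).
Proof.
move=> hu hx hy; rewrite /kanA.
rewrite (act_bilE (mul_lin u) (mul_homog hu) (mul_bil V) (@mul_homog_bil K V)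
  hx hy).
rewrite (jmulC (jmul_homog hu hy) hx).
by koszul.
Qed.

Lemma kanA_supersym u : supersym (kanA u).
Proof.
have H i u' : homog i u' -> supersym (kanA u').
  move=> hu k l x y hx hy; rewrite (kanAE hu hx hy) (kanAE hu hy hx).
  rewrite [x *j y](jmulC hx hy) (jmulC (jmul_homog hu hx) hy) !jmulE.
  rewrite (jmulC (jmul_homog hu hy) hx).
  by koszul.
move=> k l x y hx hy; rewrite -(pr_sum u) kanAD !fctE.
rewrite (H _ _ (homog_pr false u) _ _ _ _ hx hy).
by rewrite (H _ _ (homog_pr true u) _ _ _ _ hx hy); lmod_ring.
Qed.

Lemma kanA_op i k u x : homog i u -> homog k x ->
  kanA u x = scomm (L u) (L x) - (L (u *j x) : V -> V).
Proof.
move=> hu hx; apply: lin_ext; first exact: (kanA_bil u).1.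
  apply: (subspaceB (@lin_subspace K V)); last exact: mul_lin.
  by apply: scomm_lin; apply: mul_lin.
move=> l y hy; rewrite (kanAE hu hx hy).
rewrite (scommE (mul_lin u) (mul_homog hu) (mul_lin x) (mul_homog hx)).
by rewrite !fctE /=; lmod_ring.
Qed.

(** This is the Jordan identity for p, w, x, applied to y, combined with the
    fact that [L_w, L_x] is a superderivation. *)
Lemma act_mul_kanA i j p w : homog i p -> homog j w ->
  act_bil (L p) (kanA w) = - kanA (p *j w).
Proof.
move=> hp hw; apply: bil_ext.
- by apply: act_bil_bil; [apply: mul_lin | apply: kanA_bil].
- exact/(subspaceN (@bil_subspace K V))/kanA_bil.
move=> k l x y hx hy.
have m := @jmul_homog K V; have c := @jmulC K V.
rewrite (act_bil_sym (mul_lin p) (mul_homog hp) (kanA_bil w) (kanA_homog hw)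
  (@kanA_supersym w) hx hy) !fctE.
rewrite (kanAE (m _ _ _ _ hp hw) hx hy) (kanAE hw hx hy)
  (kanAE hw (m _ _ _ _ hp hx) hy) (kanAE hw hx (m _ _ _ _ hp hy)).
apply/eqP; rewrite -subr_eq0; apply/eqP.
have h1 := jordan_koszul hp hw hx hy.
have h2 := inner_derivation hw hx hp hy.
move/eqP: h2; rewrite -subr_eq0 => /eqP h2.
rewrite (c _ _ _ _ hx hp) (c _ _ _ _ hw hp) !jmulE
  (c _ _ _ _ hx (m _ _ _ _ hp hw)) in h2.
apply: (lincomb2 (a := - 1) (b := - (-1) ^+ (i && (j (+) k))) h1 h2).
rewrite !jmulE.
by koszul.
Qed.

(** Homogeneous superderivations of V, of parity i. *)
Definition superder (i : bool) : set (V -> V) :=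
  [set D | [/\ linear D, homog_end i D &
     forall k l x y, homog k x -> homog l y ->
       D (x *j y) = D x *j y + (-1) ^+ (i && k) *: (x *j D y)]].

Lemma superder_subspace i : subspace (superder i).
Proof.
split=> [|a D E [lD hD dD] [lE hE dE]]; split.
- exact: (subspace0 (@lin_subspace K V)).
- exact: (subspace0 (homog_end_subspace V i)).
- by move=> k l x y _ _; rewrite jmul0l jmul0r scaler0 addr0.
- by case: (@lin_subspace K V) => _; apply.
- by case: (homog_end_subspace V i) => _; apply.
- move=> k l x y hx hy; rewrite !fctE (dD _ _ _ _ hx hy) (dE _ _ _ _ hx hy).
  by rewrite !jmulE; lmod_ring.
Qed.

Lemma act_der_kanA i j D w : superder i D -> homog j w ->
  act_bil D (kanA w) = kanA (D w).
Proof.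
move=> [lD hD dD] hw; apply: bil_ext.
- by apply: act_bil_bil => //; apply: kanA_bil.
- exact: kanA_bil.
move=> k l x y hx hy; have m := @jmul_homog K V.
rewrite (act_bil_sym lD hD (kanA_bil w) (kanA_homog hw)
  (@kanA_supersym w) hx hy).
rewrite (kanAE (hD _ _ hw) hx hy) (kanAE hw hx hy)
  (kanAE hw (hD _ _ hx) hy) (kanAE hw hx (hD _ _ hy)) !(linE lD).
rewrite (dD _ _ _ _ hw (m _ _ _ _ hx hy)) (dD _ _ _ _ hx hy)
  (dD _ _ _ _ (m _ _ _ _ hw hx) hy) (dD _ _ _ _ hw hx)
  (dD _ _ _ _ hx (m _ _ _ _ hw hy)) (dD _ _ _ _ hw hy) !jmulE.
by koszul.
Qed.

Lemma scomm_der_mul i k D c : superder i D -> homog k c ->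
  scomm D (L c) = L (D c).
Proof.
move=> [lD hD dD] hc; apply: lin_ext.
- exact: scomm_lin lD (mul_lin c).
- exact: mul_lin.
move=> l y hy; rewrite (scommE lD hD (mul_lin c) (mul_homog hc)) !fctE /=.
by rewrite (dD _ _ _ _ hc hy); lmod_ring.
Qed.

Lemma superder_scomm i j b c : homog i b -> homog j c ->
  superder (i (+) j) (scomm (L b) (L c)).
Proof.
move=> hb hc; split.
- by apply: scomm_lin; apply: mul_lin.
- exact: scomm_homog (mul_lin b) (mul_homog hb) (mul_lin c) (mul_homog hc).
- move=> k l x y hx hy.
  rewrite (scommE (mul_lin b) (mul_homog hb) (mul_lin c) (mul_homog hc)).
  by rewrite !fctE /= (inner_derivation hb hc hx hy).
Qed.

Lemma istr_subspace : subspace (@istr K V).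
Proof. exact: span_subspace. Qed.

Lemma istr_mul b : istr (L b).
Proof. by apply: span_gen; left; exists b. Qed.

Lemma istr_scomm_mul b c : istr (scomm (L b) (L c)).
Proof. by apply: span_gen; right; exists b, c. Qed.

Lemma mulD_fun b c : L (b + c) = (L b : V -> V) + L c.
Proof. by apply: funext => x; rewrite jmulDl. Qed.

Lemma mulZ_fun a b : L (a *: b) = a *: (L b : V -> V).
Proof. by apply: funext => x; rewrite jmulZl. Qed.

Lemma mulN_fun b : L (- b) = - (L b : V -> V).
Proof. by apply: funext => x; rewrite jmulNl. Qed.

Lemma mul0_fun : L 0 = 0.
Proof. by apply: funext => x; rewrite jmul0l. Qed.

(** To prove a linear property of the elements of istr(V), it is enough to
    consider generators built from homogeneous elements of V. *)
Lemma istr_ind (Q : set (V -> V)) : subspace Q ->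
  (forall i b, homog i b -> Q (L b)) ->
  (forall i j b c, homog i b -> homog j c -> Q (scomm (L b) (L c))) ->
  @istr K V `<=` Q.
Proof.
move=> sQ QL Qs; apply: span_ind => // f [[b ->]|[b [c ->]]].
  rewrite -(pr_sum b) mulD_fun; apply: (subspaceD sQ); exact/QL/homog_pr.
have H := scomm_bilin V.
have l x := @mul_lin K V x.
have lD x y := subspaceD (@lin_subspace K V) (l x) (l y).
rewrite -(pr_sum b) -(pr_sum c) !mulD_fun !(bilinDl H) // !(bilinDr H) //.
by do ! apply: (subspaceD sQ); apply: Qs; apply: homog_pr.
Qed.

Lemma istr_lin : @istr K V `<=` linV.
Proof.
apply: istr_ind => [|i b _|i j b c _ _]; first exact: lin_subspace.
- exact: mul_lin.
- by apply: scomm_lin; apply: mul_lin.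
Qed.

Lemma pr_end_closed (Q : set (V -> V)) i j f : subspace Q ->
  linV f -> homog_end j f -> Q f -> Q (pr_end i f).
Proof.
move=> sQ lf hf qf; have := pr_end_id lf hf; have := pr_end_neg lf hf.
by case: i; case: j {hf} => /= e1 e2; rewrite ?e1 ?e2 //; apply: subspace0.
Qed.

Lemma graded_istr : graded (@istr K V) (@homog_end K V) (@pr_end K V).
Proof.
apply: graded_sub (@graded_end K V) istr_subspace istr_lin _ => i f hf.
pose Q : set (V -> V) := [set f | linV f /\ istr (pr_end i f)].
suff : Q f by case.
apply: istr_ind hf => [|k b hb|k l b c hb hc].
- split=> [|a g h [lg ig] [lh ih]].
    have l0 := subspace0 (@lin_subspace K V); split=> //.
    rewrite (_ : pr_end i 0 = 0) ; first exact: subspace0 istr_subspace.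
    by apply: funext => x; rewrite /pr_end big_bool /= !linear0 addr0.
  split; first by case: (@lin_subspace K V) => _; apply.
  rewrite (gr_linear (@graded_end K V)) //.
  by case: istr_subspace => _; apply.
- split; first exact: mul_lin.
  exact: pr_end_closed istr_subspace (mul_lin b) (mul_homog hb) (istr_mul b).
- have [ls hs _] := superder_scomm hb hc; split=> //.
  apply: (pr_end_closed _ istr_subspace ls hs); exact: istr_scomm_mul.
Qed.

End Structure.

(** * The decomposition of g_0 and the automorphism theta *)

Section Unital.
Variables (K : fieldType) (V : jordanSuperalgebra K).
Implicit Types x y z w u v : V.

Local Notation "x *j y" := (@jmul K V x y) (at level 40, left associativity).
Local Notation L := (@jmul K V).
Local Notation linV := (@lin K V).
Local Notation bilV := (@bil K V).
Local Notation istrV := (@istr K V).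

Variable e : V.
Hypothesis he : forall x, e *j x = x /\ x *j e = x.

Lemma mul1 x : e *j x = x. Proof. by case: (he x). Qed.
Lemma mulj1 x : x *j e = x. Proof. by case: (he x). Qed.

(** Let e = e0 + e1.  Comparing odd components in e * e1 = e1 and e * e0 = e0
    gives e0 * e1 = e1 and e1 * e0 = 0, so that e1 = 0. *)
Lemma unit_even : homog false e.
Proof.
pose e0 := pr V false e; pose e1 := pr V true e.
have h0 : homog false e0 by apply: homog_pr.
have h1 : homog true e1 by apply: homog_pr.
have E : e0 + e1 = e by apply: pr_sum.
have l i u v := linearD (pr V i) u v.
have h10 : e1 *j e0 = 0.
  have : pr V true (e *j e0) = 0 by rewrite mul1; apply: homog_pr_neg h0.
  rewrite -E jmulDl l (homog_pr_neg (jmul_homog h0 h0)) add0r.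
  by have := jmul_homog h1 h0; rewrite /homog /= => ->.
have e1_0 : e1 = 0.
  have : pr V true (e *j e1) = e1 by rewrite mul1.
  rewrite -E jmulDl l (homog_pr_neg (jmul_homog h1 h1)) addr0.
  by rewrite (jmulC h0 h1) h10 scaler0 linear0.
by rewrite -E e1_0 addr0.
Qed.

Lemma scomm_mul_unit b c : scomm (L b) (L c) e = 0.
Proof.
have lin1 : forall b c, L (b + c) = (L b : V -> V) + L c := @mulD_fun K V.
have H := scomm_bilin V; have lL := @mul_lin K V.
have H0 i j (b' c' : V) : homog i b' -> homog j c' -> scomm (L b') (L c') e = 0.
  move=> hb hc.
  rewrite (scommE (lL b') (mul_homog hb) (lL c') (mul_homog hc)) !fctE /=.
  by rewrite !mulj1 (jmulC hb hc) subrr.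
have lD x y := subspaceD (@lin_subspace K V) (lL x) (lL y).
rewrite -(pr_sum b) -(pr_sum c) !lin1 !(bilinDl H) // !(bilinDr H) // !fctE.
by rewrite !(H0 _ _ _ _ (homog_pr _ _) (homog_pr _ _)) !addr0.
Qed.

(** For a in istr(V), the operator a - L_{a(e)} is a superderivation. *)
Lemma istr_superder a i : istrV a -> homog_end i a ->
  superder i (a - (L (a e) : V -> V)).
Proof.
pose Q : set (V -> V) := [set f | linV f /\
   forall i, superder i (pr_end i f - (L (pr_end i f e) : V -> V))].
move=> ia hia; have la := istr_lin ia.
suff [_ /(_ i)] : Q a by rewrite pr_end_id.
apply: istr_ind ia => [|k b hb|k l b c hb hc].
- split=> [|c f g [lf df] [lg dg]].
    split; first exact: subspace0 (@lin_subspace K V).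
    move=> k; have -> : pr_end k (0 : V -> V) = 0.
      by apply: funext => x; rewrite /pr_end big_bool /= !linear0 addr0.
    rewrite (_ : (0 : V -> V) e = 0) // mul0_fun subrr.
    exact: subspace0 (superder_subspace V k).
  split; first by case: (@lin_subspace K V) => _; apply.
  move=> k; rewrite (gr_linear (@graded_end K V)) //.
  set f' := pr_end k f; set g' := pr_end k g.
  have -> : (c *: f' + g') - (L ((c *: f' + g') e) : V -> V) =
     c *: (f' - (L (f' e) : V -> V)) + (g' - (L (g' e) : V -> V)).
    by rewrite !fctE mulD_fun mulZ_fun; lmod_ring.
  by case: (superder_subspace V k) => _; apply; [apply: df | apply: dg].
- split=> [|j]; first exact: mul_lin.
  have := pr_end_id (mul_lin b) (mul_homog hb).
  have := pr_end_neg (mul_lin b) (mul_homog hb).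
  have d0 := subspace0 (superder_subspace V j).
  have z : (0 : V -> V) e = 0 by [].
  by case: j d0; case: k {hb} => /= d0 e1 e2; rewrite ?e1 ?e2 ?mulj1 ?z
    ?mul0_fun ?subrr.
- have [ls hs ds] := superder_scomm hb hc; split=> // j.
  have := pr_end_id ls hs; have := pr_end_neg ls hs.
  have d0 := subspace0 (superder_subspace V j).
  have z : (0 : V -> V) e = 0 by [].
  have d : superder (k (+) l) (scomm (L b) (L c)) by [].
  move: (k (+) l) d {hb hc hs ds} => m d.
  by case: j d0; case: m d => /= d d0 e1 e2;
    rewrite ?e1 ?e2 ?scomm_mul_unit ?z ?mul0_fun ?subr0.
Qed.

Lemma homog_unit i a : homog_end i a -> homog i (a e).
Proof. by move=> ha; have := ha _ _ unit_even; rewrite addbF. Qed.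

Lemma istr_decomp i a : istrV a -> homog_end i a ->
  exists p D, [/\ homog i p, superder i D, a = (L p : V -> V) + D & a e = p].
Proof.
move=> ia ha; exists (a e), (a - (L (a e) : V -> V)); split=> //.
- exact: homog_unit.
- exact: istr_superder.
- by rewrite addrC subrK.
Qed.

Lemma superder_lin i D : superder i D -> @lin K V D.
Proof. by case. Qed.

(** If a = L_p + D with D a superderivation, then
    [a, L_c] = [L_p, L_c] + L_{D(c)}. *)
Lemma scomm_istr_mul i k a c : istrV a -> homog_end i a -> homog k c ->
  scomm a (L c) = scomm (L (a e)) (L c) + (L (a c - a e *j c) : V -> V).
Proof.
move=> ia ha hc; have [p [D [hp dD aE pE]]] := istr_decomp ia ha.
rewrite pE {1}aE; have lD := superder_lin dD.
rewrite (bilinDl (scomm_bilin V)) //; do ?exact: mul_lin.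
rewrite (scomm_der_mul dD hc); congr (_ + jmul _).
by rewrite aE !fctE; lmod_ring.
Qed.

Lemma istr_scomm_mulr a c : istrV a -> istrV (scomm a (L c)).
Proof.
move=> ia.
have H i j b d : istrV b -> homog_end i b -> homog j d -> istrV (scomm b (L d)).
  move=> ib hb hd; rewrite (scomm_istr_mul ib hb hd).
  by apply: (subspaceD (@istr_subspace K V)); [apply: istr_scomm_mul | apply: istr_mul].
have B := scomm_bilin V; have lL := @mul_lin K V.
have lD x y := subspaceD (@lin_subspace K V) (lL x) (lL y).
have gi := graded_istr V.
have ip i : istrV (pr_end i a) by apply: (gr_closed gi).
have lp i := istr_lin (ip i).
have hp i : homog_end i (pr_end i a) by apply: (gr_part gi).
rewrite -(pr_sum c) mulD_fun (gr_sum gi ia) !(bilinDr B) //; last first.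
  exact: (subspaceD (@lin_subspace K V)).
rewrite !(bilinDl B) //.
do ! apply: (subspaceD (@istr_subspace K V)); apply: H; 
 by [apply: ip | apply: hp | apply: homog_pr].
Qed.

Lemma scomm_jacobi i j k (f g h : V -> V) :
  linV f -> homog_end i f -> linV g -> homog_end j g -> linV h -> homog_end k h ->
  scomm f (scomm g h) =
  scomm (scomm f g) h + (-1) ^+ (i && j) *: scomm g (scomm f h).
Proof.
move=> lf hf lg hg lh hh.
rewrite (scommE lf hf (scomm_lin lg lh) (scomm_homog lg hg lh hh)).
rewrite (scommE (scomm_lin lf lg) (scomm_homog lf hf lg hg) lh hh).
rewrite (scommE lg hg (scomm_lin lf lh) (scomm_homog lf hf lh hh)).
rewrite (scommE lg hg lh hh) (scommE lf hf lg hg) (scommE lf hf lh hh).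
apply: funext => x; rewrite !fctE /= ?fctE !(linE lf, linE lg, linE lh).
by koszul.
Qed.

Lemma istr_scomm a b : istrV a -> istrV b -> istrV (scomm a b).
Proof.
have B := scomm_bilin V; have lL := @mul_lin K V.
have H i f : istrV f -> homog_end i f ->
    istrV `<=` [set g | linV g /\ istrV (scomm f g)].
  move=> fi hf; have lf := istr_lin fi.
  apply: istr_ind => [|j d hd|j k d d' hd hd'].
  - split=> [|c g h [lg ig] [lh ih]].
      split; first exact: subspace0 (@lin_subspace K V).
      rewrite (bilin0r (@lin_subspace K V) B) //.
      exact: subspace0 (@istr_subspace K V).
    split; first by case: (@lin_subspace K V) => _; apply.
    by case: B => _ ->//; case: (@istr_subspace K V) => _; apply.
  - by split; [exact: lL | exact: istr_scomm_mulr].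
  - split; first exact: scomm_lin.
    rewrite (scomm_jacobi lf hf (lL d) (mul_homog hd) (lL d') (mul_homog hd')).
    apply: (subspaceD (@istr_subspace K V)).
      by apply: istr_scomm_mulr; apply: istr_scomm_mulr.
    apply: (subspaceZ (@istr_subspace K V)).
    rewrite (scomm_istr_mul fi hf hd').
    rewrite (bilinDr B); [|exact: lL|exact: scomm_lin (lL _) (lL _)|exact: lL].
    apply: (subspaceD (@istr_subspace K V)); last exact: istr_scomm_mul.
    have hp := homog_unit hf; set p := f e in hp *.
    rewrite (scommE (lL d) (mul_homog hd) (scomm_lin (lL p) (lL d'))
       (scomm_homog (lL p) (mul_homog hp) (lL d') (mul_homog hd'))).
    set E := scomm (L p) (L d').
    suff -> : (L d : V -> V) \o E - (-1) ^+ (j && (i (+) k)) *: (E \o L d) =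
      - ((-1) ^+ (j && (i (+) k)) *: scomm E (L d)).
      apply: (subspaceN (@istr_subspace K V)).
      apply: (subspaceZ (@istr_subspace K V)).
      by apply: istr_scomm_mulr; apply: istr_scomm_mul.
    rewrite (scommE (scomm_lin (lL p) (lL d'))
       (scomm_homog (lL p) (mul_homog hp) (lL d') (mul_homog hd'))
       (lL d) (mul_homog hd)) -/E.
    by koszul.
move=> ia ib; have gi := graded_istr V.
have ip i : istrV (pr_end i a) by apply: (gr_closed gi).
have lp i := istr_lin (ip i).
have hp i : homog_end i (pr_end i a) by apply: (gr_part gi).
rewrite (gr_sum gi ia) (bilinDl B) //; last exact: istr_lin.
have [_ h0] := H _ _ (ip false) (hp false) _ ib.
have [_ h1] := H _ _ (ip true) (hp true) _ ib.
exact: subspaceD (@istr_subspace K V) _ _ h0 h1.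
Qed.

(** theta(L_p + D) = D - L_p for D a superderivation, as D(e) = 0. *)
Definition theta (a : V -> V) : V -> V := a - 2%:R *: (L (a e) : V -> V).

Lemma thetaP c a b : theta (c *: a + b) = c *: theta a + theta b.
Proof. by rewrite /theta !fctE mulD_fun mulZ_fun; lmod_ring. Qed.

Lemma theta_lin a : linV a -> linV (theta a).
Proof.
move=> la; apply: (subspaceB (@lin_subspace K V)) => //.
by apply/(subspaceZ (@lin_subspace K V))/mul_lin.
Qed.

Lemma theta_homog i a : homog_end i a -> homog_end i (theta a).
Proof.
move=> ha; apply: (subspaceB (homog_end_subspace V i)) => //.
by apply/(subspaceZ (homog_end_subspace V i))/mul_homog/homog_unit.
Qed.

Lemma kanA_bilin (U W : lmodType K) (C : set U) (D : set W) (op : U -> W -> V) :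
  bilin C D op -> bilin C D (fun (r : U) (s : W) => kanA (op r s)).
Proof.
case=> hl hr; split=> [c u v w cu cv dw|c u w z cu dw dz].
  by rewrite hl // kanAP.
by rewrite hr // kanAP.
Qed.

Lemma theta_bilin : bilin istrV setT (fun a w => theta a w).
Proof.
split=> [c a b w _ _ _|c a w z /istr_lin ia _ _].
  by rewrite thetaP.
exact: theta_lin.
Qed.

(** Through theta, istr(V) acts on g_+, identified with V by w |-> A_w. *)
Lemma act_istr_kanA a w : istrV a -> act_bil a (kanA w) = kanA (theta a w).
Proof.
move=> ia; have B := @act_bil_bilin K V.
pose op (f : V -> V) x := act_bil f (kanA x).
have hop : bilin istrV setT op.
  split=> [c f g x /istr_lin lf /istr_lin lg _|c f x y /istr_lin lf _ _].
    by rewrite /op; case: B => -> //; apply: kanA_bil.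
  rewrite /op kanAP; by case: B => _ -> //; apply: kanA_bil.
have := bilin_ext (graded_istr V) (graded_space V) hop (kanA_bilin theta_bilin).
apply=> // i j f x fi hf _ hx.
have [p [D [hp dD fE pE]]] := istr_decomp fi hf.
rewrite /op /theta pE fE (bilinDl B); last exact: kanA_bil.
- rewrite (act_mul_kanA hp hx) (act_der_kanA dD hx) -kanAN -kanAD.
  by congr kanA; rewrite !fctE; lmod_ring.
- exact: mul_lin.
- exact: superder_lin dD.
Qed.

Lemma theta_scomm a b : istrV a -> istrV b ->
  theta (scomm a b) = scomm (theta a) (theta b).
Proof.
have B := scomm_bilin V; have sl := @lin_subspace K V.
apply: (bilin_ext (op := fun f g => theta (scomm f g))
  (op' := fun f g => scomm (theta f) (theta g)) (graded_istr V) (graded_istr V)).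
- split=> [c f g h|c f g h] /istr_lin lf /istr_lin lg /istr_lin lh.
    by case: B => -> // _; rewrite thetaP.
  by case: B => _ -> //; rewrite thetaP.
- split=> [c f g h|c f g h] /istr_lin/theta_lin lf /istr_lin/theta_lin lg
    /istr_lin/theta_lin lh; rewrite thetaP.
    by case: B => -> // _.
  by case: B => _ ->.
move=> i j {}a {}b ia ha ib hb; have la := istr_lin ia; have lb := istr_lin ib.
have hp := homog_unit ha; have hq := homog_unit hb.
have lp := @mul_lin K V (a e); have lq := @mul_lin K V (b e).
have Ep := scomm_istr_mul ia ha hq; have Eq := scomm_istr_mul ib hb hp.
have eE : scomm a b e = a (b e) - (-1) ^+ (i && j) *: b (a e).
  by rewrite (scommE la ha lb hb).
have lp2 := subspaceZ sl 2%:R lp; have lq2 := subspaceZ sl 2%:R lq.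
have E1 : scomm (L (a e)) b = - ((-1) ^+ (i && j) *: scomm b (L (a e))).
  rewrite (scommE lp (mul_homog hp) lb hb) (scommE lb hb lp (mul_homog hp)).
  by koszul.
have E2 : scomm (L (b e)) (L (a e)) =
    - ((-1) ^+ (i && j) *: scomm (L (a e)) (L (b e))).
  rewrite (scommE lp (mul_homog hp) lq (mul_homog hq)).
  by rewrite (scommE lq (mul_homog hq) lp (mul_homog hp)); koszul.
rewrite /theta eE !(bilinBl sl B, bilinBr sl B, bilinZl sl B, bilinZr sl B) //;
  try exact: (subspaceB sl).
rewrite Ep E1 Eq E2 !(mulD_fun, mulN_fun, mulZ_fun) (jmulC hq hp) mulZ_fun.
by koszul.
Qed.

End Unital.

(** * The Lie superalgebra Kan(V) *)

Section KanLie.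
Variables (K : fieldType) (V : jordanSuperalgebra K).
Implicit Types x y z w u v : V.

Local Notation "x *j y" := (@jmul K V x y) (at level 40, left associativity).
Local Notation L := (@jmul K V).
Local Notation linV := (@lin K V).
Local Notation bilV := (@bil K V).
Local Notation istrV := (@istr K V).

Variable e : V.
Hypothesis he : forall x, e *j x = x /\ x *j e = x.
Let e0 : homog false e := unit_even he.

Lemma kanA_e w x : kanA w x e = - (w *j x).
Proof.
have H i k a b : homog i a -> homog k b -> kanA a b e = - (a *j b).
  move=> ha hb; rewrite (kanAE ha hb e0) !(mulj1 he) (jmulC hb ha).
  by koszul.
rewrite -(pr_sum w) -(pr_sum x) kanAD !fctE !(linD ((kanA_bil _).2 _)).
by rewrite !(H _ _ _ _ (homog_pr _ _) (homog_pr _ _)) !jmulE; lmod_ring.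
Qed.

Lemma kanA_ee w : kanA w e e = - w.
Proof. by rewrite kanA_e (mulj1 he). Qed.

(** P itself is among the A_w, because P = - A_e. *)
Lemma kan_posP (B : V -> V -> V) : kan_pos B <-> exists w, B = kanA w.
Proof.
split=> [|[w ->]]; last by apply: span_gen; right; exists w.
apply: (@span_ind K _ _ [set B | exists w, B = kanA w]) B => [|B].
  split=> [|a B C [u ->] [v ->]]; first by exists 0; rewrite kanA0.
  by exists (a *: u + v); rewrite kanAP.
move=> [->|[w ->]]; last by exists w.
exists (- e); rewrite kanAN; apply: bil_ext.
- exact: mul_bil.
- exact/(subspaceN (@bil_subspace K V))/kanA_bil.
- move=> k l x y hx hy.
  by rewrite !fctE (kanAE e0 hx hy) !(mul1 he); koszul.
Qed.

Lemma kan_pos_kanA w : kan_pos (kanA w).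
Proof. by apply/kan_posP; exists w. Qed.

Lemma kan_pos_bil : @kan_pos K V `<=` bilV.
Proof. by move=> B /kan_posP [w ->]; apply: kanA_bil. Qed.

Lemma kan_pos_subspace : subspace (@kan_pos K V).
Proof. exact: span_subspace. Qed.

Lemma pr_bil_kanA i w : pr_bil i (kanA w) = kanA (pr V i w).
Proof.
have H := @kanA_bil K V; have g := graded_bil V.
have -> : kanA w = 1 *: kanA (pr V false w) + kanA (pr V true w).
  by rewrite scale1r -kanAD pr_sum.
rewrite (gr_linear g) // scale1r.
have h j := kanA_homog (homog_pr j w).
have E j := gr_id g (H (pr V j w)) (h j).
have N j := gr_neg g (H (pr V j w)) (h j).
by case: i; rewrite ?E ?(N true) ?(N false) ?addr0 ?add0r.
Qed.

Lemma graded_kan_pos : graded (@kan_pos K V) (@homog_bil K V) (@pr_bil K V).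
Proof.
apply: graded_sub (@graded_bil K V) kan_pos_subspace kan_pos_bil _ => i B.
by move=> /kan_posP [w ->]; rewrite pr_bil_kanA; apply: kan_pos_kanA.
Qed.

Lemma homog_kanA i w : homog_bil i (kanA w) -> homog i w.
Proof.
move=> /(_ _ _ _ _ e0 e0); rewrite kanA_ee !addbF => /homogN.
by rewrite opprK.
Qed.

Lemma kan_partP i X : @kan_part K V i X <-> exists x a u,
  [/\ X = (x, a, kanA u), homog i x, istrV a /\ homog_end i a & homog i u].
Proof.
split=> [|[x [a [u [-> hx [ia ha] hu]]]]].
  case: X => [[x a] A] [[/= ia /kan_posP [u ->]] hx ha hu].
  by exists x, a, u; split=> //; apply: homog_kanA.
by split=> //; [split=> //; apply: kan_pos_kanA | apply: kanA_homog].
Qed.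

Let act (c : V -> V) (z : V) : V := c z.
Let ev (C : V -> V -> V) (z : V) : V -> V := C z.

Lemma act_bilin : bilin linV setT act.
Proof. by split=> // a f x y lf _ _; rewrite /act lf. Qed.

Lemma ev_bilin : bilin bilV setT ev.
Proof.
split=> // a B x y hB _ _; apply: funext => z.
exact: hB.2.
Qed.

(** The bracket of Kan(V) on homogeneous elements. *)
Lemma kan_bracketE i j x y (a b : V -> V) u v :
  homog i x -> homog j y -> homog i u -> homog j v ->
  istrV a -> homog_end i a -> istrV b -> homog_end j b ->
  kan_bracket (x, a, kanA u) (y, b, kanA v) =
  (a y - (-1) ^+ (i && j) *: b x,
   scomm a b + kanA u y - (-1) ^+ (i && j) *: kanA v x,
   kanA (theta e a v - (-1) ^+ (i && j) *: theta e b u)).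
Proof.
move=> hx hy hu hv ia ha ib hb; have la := istr_lin ia; have lb := istr_lin ib.
have gV := graded_space V; have gE := graded_end V; have gB := graded_bil V.
rewrite /kan_bracket.
rewrite (sflipE gE gV act_bilin lb hb I hx).
rewrite (sflipE gB gV ev_bilin (kanA_bil v) (kanA_homog hv) I hx).
rewrite (sflipE gE gB (@act_bil_bilin K V) lb hb (kanA_bil u) (kanA_homog hu)).
rewrite !(act_istr_kanA he) // [j && i]andbC -kanAZ -kanAN -kanAD.
by [].
Qed.

Lemma kanA_istr i j u x : homog i u -> homog j x -> istrV (kanA u x).
Proof.
move=> hu hx; rewrite (kanA_op hu hx).
apply: (subspaceB (@istr_subspace K V)); first exact: istr_scomm_mul.
exact: istr_mul.
Qed.

Lemma kanA_homog_end i j u x : homog i u -> homog j x ->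
  homog_end (i (+) j) (kanA u x).
Proof. by move=> hu hx k y hy; apply: kanA_homog. Qed.

(** The formula for [a, A_v], read as an equality of operators. *)
Lemma kanA_theta i j k a v z :
  istrV a -> homog_end i a -> homog j v -> homog k z ->
  scomm a (kanA v z) = kanA (theta e a v) z + (-1) ^+ (i && j) *: kanA v (a z).
Proof.
move=> ia ha hv hz; have la := istr_lin ia.
have lz := istr_lin (kanA_istr hv hz).
have Bl w x : linV (kanA w x) := (kanA_bil w).1 x.
apply: lin_ext; first exact: scomm_lin.
  apply: (subspaceD (@lin_subspace K V)); first exact: Bl.
  exact/(subspaceZ (@lin_subspace K V))/Bl.
move=> l y hy; rewrite -(act_istr_kanA he v ia) !fctE.
rewrite (scommE la ha lz (kanA_homog_end hv hz)) !fctE /=.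
rewrite (act_bil_sym la ha (kanA_bil v) (kanA_homog hv)
  (@kanA_supersym _ _ v) hz hy).
by lmod_ring.
Qed.

Lemma theta_kanA i j v z : homog i v -> homog j z ->
  theta e (kanA v z) = scomm (L v) (L z) + (L (v *j z) : V -> V).
Proof.
move=> hv hz; rewrite /theta kanA_e mulN_fun (kanA_op hv hz).
by lmod_ring.
Qed.

(** Twice theta(A_v(z)) u is the triple product {v, z, u}, which is
    supersymmetric in v and u. *)
Lemma theta_kanA_sym i j k v z u : homog i v -> homog j z -> homog k u ->
  theta e (kanA v z) u =
  (-1) ^+ ((i && j) + (i && k) + (j && k)) *: theta e (kanA u z) v.
Proof.
move=> hv hz hu; rewrite (theta_kanA hv hz) (theta_kanA hu hz).
rewrite (scommE (mul_lin v) (mul_homog hv) (mul_lin z) (mul_homog hz)).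
rewrite (scommE (mul_lin u) (mul_homog hu) (mul_lin z) (mul_homog hz)).
rewrite !fctE /= (jmulC (jmul_homog hu hz) hv) (jmulC (jmul_homog hv hz) hu).
rewrite (jmulC hu hv) (jmulC hu hz) (jmulC hv hz) !jmulE.
by koszul.
Qed.

Lemma kan_scaleN (s : K) (x : V) (a : V -> V) (A : V -> V -> V) :
  - (s *: ((x, a, A) : kan_ambient V)) = (- (s *: x), - (s *: a), - (s *: A)).
Proof. by []. Qed.

Lemma kan_addZ (s : K) (x y : V) (a b : V -> V) (A B : V -> V -> V) :
  ((x, a, A) : kan_ambient V) + s *: ((y, b, B) : kan_ambient V) =
  (x + s *: y, a + s *: b, A + s *: B).
Proof. by []. Qed.

Section Homogeneous.
Variables (i j : bool) (x y u v : V) (a b : V -> V).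
Hypotheses (hx : homog i x) (hy : homog j y) (hu : homog i u) (hv : homog j v).
Hypotheses (ia : istrV a) (ib : istrV b).
Hypotheses (ha : homog_end i a) (hb : homog_end j b).

Lemma kan_homog1 : homog (i (+) j) (a y - (-1) ^+ (i && j) *: b x).
Proof.
apply: homogD; first exact: ha.
by apply/homogN/homogZ; rewrite addbC; apply: hb.
Qed.

Lemma kan_homog3 :
  homog (i (+) j) (theta e a v - (-1) ^+ (i && j) *: theta e b u).
Proof.
apply: homogD; first exact: (theta_homog he ha).
by apply/homogN/homogZ; rewrite addbC; apply: (theta_homog he hb).
Qed.

Lemma kan_istr :
  istrV (scomm a b + kanA u y - (-1) ^+ (i && j) *: kanA v x).
Proof.
apply: (subspaceB (@istr_subspace K V)).
  apply: (subspaceD (@istr_subspace K V)); first exact: istr_scomm he _ _ ia ib.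
  exact: kanA_istr hu hy.
apply: (subspaceZ (@istr_subspace K V)); exact: kanA_istr hv hx.
Qed.

Lemma kan_homog2 : homog_end (i (+) j)
  (scomm a b + kanA u y - (-1) ^+ (i && j) *: kanA v x).
Proof.
have s := homog_end_subspace V (i (+) j).
apply: (subspaceB s).
  apply: (subspaceD s); last exact: kanA_homog_end.
  exact: scomm_homog (istr_lin ia) ha (istr_lin ib) hb.
by apply: (subspaceZ s); rewrite addbC; apply: kanA_homog_end.
Qed.

Lemma kan_part_bracket :
  kan_part (i (+) j) (kan_bracket (x, a, kanA u) (y, b, kanA v)).
Proof.
rewrite (kan_bracketE hx hy hu hv ia ha ib hb); apply/kan_partP.
by do 3 eexists; split; [reflexivity|exact: kan_homog1|split;
 [exact: kan_istr|exact: kan_homog2]|exact: kan_homog3].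
Qed.

End Homogeneous.

Lemma kan_antisymmetry i j X Y : @kan_part K V i X -> @kan_part K V j Y ->
  kan_bracket X Y = - ((-1) ^+ (i && j) *: kan_bracket Y X).
Proof.
move=> /kan_partP [x [a [u [-> hx [ia ha] hu]]]].
move=> /kan_partP [y [b [v [-> hy [ib hb] hv]]]].
rewrite (kan_bracketE hx hy hu hv ia ha ib hb).
rewrite (kan_bracketE hy hx hv hu ib hb ia ha).
have la := istr_lin ia; have lb := istr_lin ib.
rewrite (scommE la ha lb hb) (scommE lb hb la ha).
rewrite kan_scaleN; congr (_, _, _).
- by koszul.
- by koszul.
- by rewrite -kanAZ -kanAN; congr kanA; koszul.
Qed.

(** Each component of the Jacobi identity is checked separately.  The component
    in g_- uses that the A_u are supersymmetric, the one in g_0 the Jacobi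
    identity of supercommutators and the definition of [a, A_u], and the one
    in g_+, read in V through w |-> A_w, the identities [theta_scomm] and
    [theta_kanA_sym]. *)
Lemma kan_jacobi i j k X Y Z :
  @kan_part K V i X -> @kan_part K V j Y -> @kan_part K V k Z ->
  kan_bracket X (kan_bracket Y Z) = kan_bracket (kan_bracket X Y) Z
    + (-1) ^+ (i && j) *: kan_bracket Y (kan_bracket X Z).
Proof.
move=> /kan_partP [x [a [u [-> hx [ia ha] hu]]]].
move=> /kan_partP [y [b [v [-> hy [ib hb] hv]]]].
move=> /kan_partP [z [c [w [-> hz [ic hc] hw]]]].
have la := istr_lin ia; have lb := istr_lin ib; have lc := istr_lin ic.
rewrite (kan_bracketE hy hz hv hw ib hb ic hc).
rewrite (kan_bracketE hx hz hu hw ia ha ic hc).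
rewrite (kan_bracketE hx hy hu hv ia ha ib hb).
rewrite (kan_bracketE hx (kan_homog1 hy hz hb hc) hu (kan_homog3 hv hw hb hc)
  ia ha (kan_istr hy hz hv hw ib ic) (kan_homog2 hy hz hv hw ib ic hb hc)).
rewrite (kan_bracketE hy (kan_homog1 hx hz ha hc) hv (kan_homog3 hu hw ha hc)
  ib hb (kan_istr hx hz hu hw ia ic) (kan_homog2 hx hz hu hw ia ic ha hc)).
rewrite (kan_bracketE (kan_homog1 hx hy ha hb) hz (kan_homog3 hu hv ha hb) hw
  (kan_istr hx hy hu hv ia ib) (kan_homog2 hx hy hu hv ia ib ha hb) ic hc).
rewrite kan_addZ; congr (_, _, _).
- rewrite (scommE la ha lb hb) (scommE la ha lc hc) (scommE lb hb lc hc).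
  rewrite !fctE /= !(linE la, linE lb, linE lc).
  rewrite (kanA_supersym v hz hx) (kanA_supersym w hy hx) (kanA_supersym u hz hy).
  by koszul.
- have B := scomm_bilin V; have sl := @lin_subspace K V.
  have lA s t : linV (kanA s t) := (kanA_bil s).1 t.
  have ls f g (lf : linV f) (lg : linV g) := scomm_lin lf lg.
  have F m n r f s t (if_ : istrV f) (hf : homog_end r f) (hs : homog m s)
      (ht : homog n t) : scomm (kanA s t) f =
        - ((-1) ^+ ((m (+) n) && r) *: scomm f (kanA s t)).
    rewrite (scommE (lA s t) (kanA_homog_end hs ht) (istr_lin if_) hf).
    rewrite (scommE (istr_lin if_) hf (lA s t) (kanA_homog_end hs ht)).
    by clear; koszul.
  have lZ r f := subspaceZ sl r (u := f).
  have lD f g := subspaceD sl (u:=f) (v:=g).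
  have lN f := subspaceN sl (u := f).
  have D s t r : kanA s (t + r) = kanA s t + kanA s r.
    by apply: funext => m; rewrite (linD ((kanA_bil s).2 m)).
  have Zz s r t : kanA s (r *: t) = r *: kanA s t.
    by apply: funext => m; rewrite (linZ ((kanA_bil s).2 m)).
  have N s t : kanA s (- t) = - kanA s t.
    by apply: funext => m; rewrite (linN ((kanA_bil s).2 m)).
  rewrite !(bilinBl sl B, bilinBr sl B, bilinDl B, bilinDr B,
            bilinZl sl B, bilinZr sl B); try by auto 6.
  rewrite (scomm_jacobi la ha lb hb lc hc).
  rewrite (F _ _ _ _ _ _ ic hc hu hy) (F _ _ _ _ _ _ ic hc hv hx).
  rewrite (kanA_theta ia ha hv hz) (kanA_theta ia ha hw hy).
  rewrite (kanA_theta ib hb hu hz) (kanA_theta ib hb hw hx).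
  rewrite (kanA_theta ic hc hu hy) (kanA_theta ic hc hv hx).
  rewrite !(kanAD, kanAN, kanAZ, D, N, Zz) !fctE.
  (* what is left is a linear relation between these operators *)
  repeat match goal with |- context [kanA ?p ?q] =>
    generalize (kanA p q); intro end.
  repeat match goal with |- context [scomm ?p ?q] =>
    generalize (scomm p q); intro end.
  by apply: funext => r; koszul.
- rewrite -kanAZ -kanAD; congr kanA.
  have tD f g : theta e (f + g) = theta e f + theta e g.
    by have := thetaP e 1 f g; rewrite !scale1r.
  have t0 : theta e 0 = 0.
    by rewrite /theta (_ : (0 : V -> V) e = 0) // mul0_fun scaler0 subr0.
  have tZ r f : theta e (r *: f) = r *: theta e f.
    by have := thetaP e r f 0; rewrite t0 !addr0.
  have tN f : theta e (- f) = - theta e f by rewrite -scaleN1r tZ scaleN1r.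
  have lta := theta_lin e la; have ltb := theta_lin e lb.
  have ltc := theta_lin e lc.
  have hta := theta_homog he ha; have htb := theta_homog he hb.
  have htc := theta_homog he hc.
  rewrite !(tD, tN, tZ) !(theta_scomm he) //.
  rewrite (scommE lta hta ltb htb) (scommE lta hta ltc htc).
  rewrite (scommE ltb htb ltc htc) !fctE /= !(linE lta, linE ltb, linE ltc).
  rewrite (theta_kanA_sym hv hz hu) (theta_kanA_sym hw hy hu).
  rewrite (theta_kanA_sym hw hx hv).
  repeat match goal with |- context [theta e ?f] =>
    generalize (theta e f); intro end.
  by koszul.
Qed.

End KanLie.

Section KanIsLie.
Variables (K : fieldType) (V : jordanSuperalgebra K).
Implicit Types x y z w u v : V.

Local Notation "x *j y" := (@jmul K V x y) (at level 40, left associativity).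
Local Notation L := (@jmul K V).
Local Notation linV := (@lin K V).
Local Notation bilV := (@bil K V).
Local Notation istrV := (@istr K V).

Variable e : V.
Hypothesis he : forall x, e *j x = x /\ x *j e = x.

Lemma kan_linP (a : K) (x y : V) (f g : V -> V) (A B : V -> V -> V) :
  (a *: x + y, a *: f + g, a *: A + B) =
  a *: ((x, f, A) : kan_ambient V) + ((y, g, B) : kan_ambient V).
Proof. by []. Qed.

Lemma kan_lie : is_lie_superalgebra (Kan V).
Proof.
have gV := graded_space V; have gE := graded_istr V.
have gP := graded_kan_pos he.
have B0 := scomm_bilin V; have B1 := act_bilin V; have B2 := ev_bilin V.
have B3 := @act_bil_bilin K V.
have S1 := sflip_bilin (graded_end V) gV B1.
have S2 := sflip_bilin (graded_bil V) gV B2.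
have S3 := sflip_bilin (graded_end V) (graded_bil V) B3.
split.
- split.
    split; first exact: subspace0 (@istr_subspace K V).
    exact: subspace0 (@kan_pos_subspace K V).
  move=> a X Y [hX hX'] [hY hY']; split.
    by case: (@istr_subspace K V) => _; apply.
  by case: (@kan_pos_subspace K V) => _; apply.
- move=> i; split.
    split; [split| | |].
    + exact: subspace0 (@istr_subspace K V).
    + exact: subspace0 (@kan_pos_subspace K V).
    + exact: subspace0 (homog_subspace V i).
    + exact: subspace0 (homog_end_subspace V i).
    + exact: subspace0 (homog_bil_subspace V i).
  move=> a X Y [[iX kX] h1X h2X h3X] [[iY kY] h1Y h2Y h3Y]; split; [split| | |].
  + by case: (@istr_subspace K V) => _; apply.
  + by case: (@kan_pos_subspace K V) => _; apply.
  + by case: (homog_subspace V i) => _; apply.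
  + by case: (homog_end_subspace V i) => _; apply.
  + by case: (homog_bil_subspace V i) => _; apply.
- by move=> i X [].
- move=> [[x a] A] [/= ia kA].
  exists (pr V false x, pr_end false a, pr_bil false A).
  exists (pr V true x, pr_end true a, pr_bil true A).
  split; [split; [split| | |]|split; [split| | |]|] => //;
  do ?[exact: (gr_closed gE)|exact: (gr_closed gP)|exact: homog_pr
      |exact: (gr_part gE)|exact: (gr_part gP)].
  rewrite {1}(gr_sum gE ia) {1}(gr_sum gP kA) -{1}(pr_sum x).
  by [].
- move=> [[x a] A] [[[/= ia kA] h1 h2 h3] [_ /= h1' h2' h3']].
  rewrite (graded_direct gV I h1 h1') (graded_direct gE ia h2 h2').
  by rewrite (graded_direct gP kA h3 h3').
- move=> a [[x f] A] [[y g] B] [[z h] C] [/= /istr_lin lf /(kan_pos_bil he) bA].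
  move=> [/= /istr_lin lg /(kan_pos_bil he) bB].
  move=> [/= /istr_lin lh /(kan_pos_bil he) bC].
  rewrite -[LHS]/(kan_bracket (a *: x + y, a *: f + g, a *: A + B) (z, h, C)).
  rewrite -[RHS]kan_linP; congr (_, _, _).
  + by rewrite S1.1 // B1.1 //; lmod_ring.
  + by rewrite S2.1 // B2.1 // B0.1 //; lmod_ring.
  + by rewrite S3.1 // B3.1 //; lmod_ring.
- move=> a [[x f] A] [[y g] B] [[z h] C] [/= /istr_lin lf /(kan_pos_bil he) bA].
  move=> [/= /istr_lin lg /(kan_pos_bil he) bB].
  move=> [/= /istr_lin lh /(kan_pos_bil he) bC].
  rewrite -[LHS]/(kan_bracket (z, h, C) (a *: x + y, a *: f + g, a *: A + B)).
  rewrite -[RHS]kan_linP; congr (_, _, _).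
  + by rewrite S1.2 // lh; lmod_ring.
  + by rewrite S2.2 // (B2.2 a C x y) // B0.2 //; lmod_ring.
  + by rewrite S3.2 // B3.2 //; lmod_ring.
- move=> i j X Y /(kan_partP he) [x [a [u [-> hx [ia ha] hu]]]].
  move=> /(kan_partP he) [y [b [v [-> hy [ib hb] hv]]]].
  exact: kan_part_bracket he _ _ _ _ _ _ _ _ hx hy hu hv ia ib ha hb.
- exact: kan_antisymmetry he.
- exact: kan_jacobi he.
Qed.
End KanIsLie.

(** * Transport of structure *)

(** A bijection f between carriers that respects all the structure transports
    a Lie superalgebra structure from g to h. *)
Lemma lie_transport (K : fieldType) (g h : bracketSpace K)
    (f : ambient g -> ambient h) (f' : ambient h -> ambient g) :
  is_lie_superalgebra g -> subspace (carrier h) ->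
  (forall x, carrier g x -> carrier h (f x)) ->
  (forall y, carrier h y -> carrier g (f' y)) ->
  (forall x, carrier g x -> f' (f x) = x) ->
  (forall y, carrier h y -> f (f' y) = y) ->
  (forall a x y, carrier g x -> carrier g y ->
     f (a *: x + y) = a *: f x + f y) ->
  (forall i x, part g i x -> part h i (f x)) ->
  (forall i y, part h i y -> part g i (f' y)) ->
  (forall i, part h i `<=` carrier h) ->
  (forall x y, carrier g x -> carrier g y ->
     f (bracket x y) = bracket (f x) (f y)) ->
  lie_superalgebra_isomorphic g h.
Proof.
move=> lg sh cf cf' fK f'K fP pf pf' psub fB.
have [sg spg psubg psum pdir ll lr pb anti jac] := lg.
have f0 : f 0 = 0.
  have := fP 1 0 0 (subspace0 sg) (subspace0 sg).
  rewrite scaler0 addr0 scale1r => E.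
  by apply: (@addrI _ (f 0)); rewrite addr0 -E.
have fZ a x : carrier g x -> f (a *: x) = a *: f x.
  by move=> cx; have := fP a x 0 cx (subspace0 sg); rewrite f0 !addr0.
have fD x y : carrier g x -> carrier g y -> f (x + y) = f x + f y.
  by move=> cx cy; have := fP 1 x y cx cy; rewrite !scale1r.
have cZ a x : carrier g x -> carrier g (a *: x) by exact: (subspaceZ sg).
have cD x y : carrier g x -> carrier g y -> carrier g (x + y).
  exact: (subspaceD sg).
have cP a x y : carrier g x -> carrier g y -> carrier g (a *: x + y).
  by move=> cx cy; apply: (cD) => //; apply: (cZ).
have cB x y : carrier g x -> carrier g y -> carrier g (bracket x y).
  move=> cx cy; have [x0 [x1 [px0 px1 ->]]] := psum x cx.
  have [y0 [y1 [py0 py1 ->]]] := psum y cy.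
  have cx0 := psubg _ _ px0; have cx1 := psubg _ _ px1.
  have cy0 := psubg _ _ py0; have cy1 := psubg _ _ py1.
  rewrite -[x0]scale1r ll // ?scale1r; last exact: cD.
  rewrite -[y0]scale1r !lr // !scale1r.
  by apply: (cD); apply: (cD); apply: psubg (pb _ _ _ _ _ _);
    [exact: px0|exact: py0|exact: px0|exact: py1
    |exact: px1|exact: py0|exact: px1|exact: py1].
have f'P a x y : carrier h x -> carrier h y ->
    f' (a *: x + y) = a *: f' x + f' y.
  move=> cx cy; have cx' := cf' _ cx; have cy' := cf' _ cy.
  by rewrite -{1}(f'K _ cx) -{1}(f'K _ cy) -fP // fK //; apply: (cP).
have f'0 : f' 0 = 0 by rewrite -f0 fK //; apply: subspace0 sg.
have ph i x : part h i x -> [/\ carrier h x, part g i (f' x) & x = f (f' x)].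
  by move=> px; have cx := psub _ _ px; rewrite f'K //; split=> //; apply: pf'.
split=> //; last first.
  exists f; split=> //.
  split=> // [x y /set_mem cx /set_mem cy E|y cy].
    by rewrite -(fK x cx) E fK.
  by exists (f' y); rewrite ?f'K //; apply: cf'.
split=> //.
- move=> i; split; first by rewrite -f0; apply: pf; apply: subspace0 (spg i).
  move=> a u v /ph [_ pu ->] /ph [_ pv ->].
  rewrite -fP; [|exact: psubg pu|exact: psubg pv].
  by apply: pf; case: (spg i) => _; apply.
- move=> x cx; have [y [z [py pz E]]] := psum _ (cf' _ cx).
  exists (f y), (f z); split; [exact: pf|exact: pf|].
  by rewrite -fD -?E ?f'K //; [exact: psubg py|exact: psubg pz].
- move=> x [/ph [_ p0 E] /ph [_ p1 _]] /=.
  by rewrite E (_ : f' x = 0) //; apply: pdir.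
- move=> a x y z cx cy cz; have cx' := cf' _ cx; have cy' := cf' _ cy.
  have cz' := cf' _ cz.
  rewrite -(f'K _ cx) -(f'K _ cy) -(f'K _ cz) -fP // -!fB //; last exact: cP.
  by rewrite ll // fP //; apply: (cB).
- move=> a x y z cx cy cz; have cx' := cf' _ cx; have cy' := cf' _ cy.
  have cz' := cf' _ cz.
  rewrite -(f'K _ cx) -(f'K _ cy) -(f'K _ cz) -fP // -!fB //; last exact: cP.
  by rewrite lr // fP //; apply: (cB).
- move=> i j x y /ph [_ px ->] /ph [_ py ->].
  rewrite -fB; [|exact: psubg px|exact: psubg py].
  exact/pf/pb.
- move=> i j x y /ph [_ px ->] /ph [_ py ->].
  have cx := psubg _ _ px; have cy := psubg _ _ py.
  rewrite -!fB // (anti _ _ _ _ px py) -scaleNr fZ ?scaleNr //.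
  exact: cB.
- move=> i j k x y z /ph [_ px ->] /ph [_ py ->] /ph [_ pz ->].
  have cx := psubg _ _ px; have cy := psubg _ _ py; have cz := psubg _ _ pz.
  rewrite -!fB //; do ?[exact: cB].
  rewrite (jac _ _ _ _ _ _ px py pz) fD ?fZ //; do ?[exact: cB].
  - by apply: (cB) => //; apply: (cB).
  - by apply: (cB) => //; apply: (cB).
  - by apply: (cZ); apply: (cB) => //; apply: (cB).
Qed.

(** * The Lie superalgebra Ko(V) and the isomorphism *)

Section Koecher.
Variables (K : fieldType) (V : jordanSuperalgebra K).
Implicit Types x y z w u v : V.

Local Notation "x *j y" := (@jmul K V x y) (at level 40, left associativity).
Local Notation L := (@jmul K V).
Local Notation linV := (@lin K V).
Local Notation bilV := (@bil K V).
Local Notation istrV := (@istr K V).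

Variable e : V.
Hypothesis he : forall x, e *j x = x /\ x *j e = x.
Hypothesis two_neq0 : (2%:R : K) != 0.
Let e0 : homog false e := unit_even he.

Lemma koD_bilin : bilin setT setT (@koD K V).
Proof.
have B := scomm_bilin V; have sl := @lin_subspace K V.
have l x := @mul_lin K V x.
split=> c x y z _ _ _; rewrite /koD.
- by rewrite !jmulE !mulD_fun !mulZ_fun B.1 //; lmod_ring.
- by rewrite !jmulE !mulD_fun !mulZ_fun B.2 //; lmod_ring.
Qed.

Lemma koD_istr x u : istrV (koD x u).
Proof.
have s := @istr_subspace K V.
by apply: (subspaceD s); apply: (subspaceZ s); [apply: istr_mul|apply: istr_scomm_mul].
Qed.

Lemma koD_unit x u : koD x u e = 2%:R *: (x *j u).
Proof. by rewrite /koD !fctE (scomm_mul_unit he) (mulj1 he) scaler0 addr0. Qed.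

Lemma sflip_koD_theta x u : sflip (pr V) (pr V) (@koD K V) x u = theta e (koD x u).
Proof.
have gV := graded_space V; have B := koD_bilin.
apply: (bilin_ext (op := sflip (pr V) (pr V) (@koD K V))
  (op' := fun y v => theta e (koD y v)) gV gV) => //.
- exact: (sflip_bilin gV gV B).
- split=> c y z v _ _ _; first by rewrite B.1 // thetaP.
  by rewrite B.2 // thetaP.
move=> i j {}x {}u _ hx _ hu.
rewrite (sflipE gV gV B I hu I hx) /theta koD_unit /koD.
rewrite (jmulC hu hx) !mulZ_fun.
rewrite (scommE (mul_lin u) (mul_homog hu) (mul_lin x) (mul_homog hx)).
rewrite (scommE (mul_lin x) (mul_homog hx) (mul_lin u) (mul_homog hu)).
by koszul.
Qed.

(** The second component of an inner operator is determined by the first one. *)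
Lemma koDDE x u : koDD x u = (koD x u, theta e (koD x u)).
Proof. by rewrite /koDD sflip_koD_theta. Qed.

Lemma scomm_mul1 x : scomm (L x) (L e) = 0.
Proof.
have B := scomm_bilin V; have l y := @mul_lin K V y.
have H i y : homog i y -> scomm (L y) (L e) = 0.
  move=> hy; rewrite (scommE (l y) (mul_homog hy) (l e) (mul_homog e0)).
  by apply: funext => z; rewrite !fctE /= !(mul1 he) andbF scale1r subrr.
rewrite -(pr_sum x) mulD_fun (bilinDl B) //.
by rewrite !(H _ _ (homog_pr _ _)) addr0.
Qed.

Lemma koD_mul x : (L x : V -> V) = 2%:R^-1 *: koD x e.
Proof.
by rewrite /koD scomm_mul1 scaler0 addr0 (mulj1 he) scalerA mulVf // scale1r.
Qed.

Lemma inn_subspace : subspace (@inn K V).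
Proof. exact: span_subspace. Qed.

(** Inn(V, V) is the graph of theta on istr(V). *)
Lemma innP (T : (V -> V) * (V -> V)) :
  inn T <-> istrV T.1 /\ T.2 = theta e T.1.
Proof.
have s := @istr_subspace K V; split.
  apply: (@span_ind K _ _ [set T | istrV T.1 /\ T.2 = theta e T.1]) T.
    split=> [|c T T' [h1 h2] [h1' h2']].
      split; first exact: subspace0 s.
      rewrite /= /theta (_ : (0 : V -> V) e = 0) // mul0_fun scaler0 subr0 //.
    by split; [case: s => _; apply | rewrite /= thetaP h2 h2'].
  by move=> T [x [u ->]]; rewrite koDDE; split=> //; apply: koD_istr.
case: T => a b [/= ia ->].
pose Q : set (V -> V) := [set f | inn (f, theta e f)].
have sQ : subspace Q.
  split=> [|c f g qf qg].
    rewrite /Q /= /theta (_ : (0 : V -> V) e = 0) // mul0_fun scaler0 subr0.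
    exact: subspace0 inn_subspace.
  rewrite /Q /= thetaP; case: inn_subspace => _ h.
  exact: h c _ _ qf qg.
have QD x u : Q (koD x u) by rewrite /Q /= -koDDE; apply: span_gen; exists x, u.
have QL x : Q (L x) by rewrite koD_mul; apply: (subspaceZ sQ).
apply: (span_ind sQ) ia => f [[x ->]|[x [u ->]]] //.
have -> : scomm (L x) (L u) = 2%:R^-1 *: koD x u - (L (x *j u) : V -> V).
  rewrite /koD scalerDr !scalerA mulVf // !scale1r; lmod_ring.
by apply: (subspaceB sQ) => //; apply: (subspaceZ sQ).
Qed.

(** The isomorphism and its inverse. *)
Definition kan_to_ko (X : kan_ambient V) : ko_ambient V :=
  (X.1.1, (X.1.2, theta e X.1.2), - 2%:R^-1 *: X.2 e e).

Definition ko_to_kan (Y : ko_ambient V) : kan_ambient V :=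
  (Y.1.1, Y.1.2.1, kanA (2%:R *: Y.2)).

Lemma half_kanA w : - 2%:R^-1 *: kanA w e e = 2%:R^-1 *: w.
Proof. by rewrite (kanA_ee he) scaleNr scalerN opprK. Qed.

Lemma pr_end_theta i b : istrV b -> pr_end i (theta e b) = theta e (pr_end i b).
Proof.
move=> /istr_lin lb; have g := graded_end V.
apply: (graded_morph (f := theta e) i g g) => //.
- by move=> f h _ _; have := thetaP e 1 f h; rewrite !scale1r.
- by move=> f; apply: theta_lin.
- by move=> j f _; apply: theta_homog.
Qed.

(** Here and in the next lemma, A_w in g_+ corresponds to w/2 in V^-: the
    brackets [A_w, y] and [x, A_w] of Kan(V) agree with those of Ko(V). *)
Lemma kanA_koD w y : kanA w y = sflip (pr V) (pr V) (@koD K V) (2%:R^-1 *: w) y.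
Proof.
have gV := graded_space V; have S := sflip_bilin gV gV koD_bilin.
rewrite (bilinZl (gr_subspace gV) S) //.
apply: (bilin_ext (op := @kanA K V)
 (op' := fun w y => 2%:R^-1 *: sflip (pr V) (pr V) (@koD K V) w y) gV gV) => //.
- split=> c x z t _ _ _; first by rewrite kanAP.
  by apply: funext => r; rewrite ((kanA_bil x).2 r).
- split=> c x z t _ _ _; first by rewrite S.1 //; lmod_ring.
  by rewrite S.2 //; lmod_ring.
move=> i j {}w {}y _ hw _ hy.
rewrite (sflipE gV gV koD_bilin I hy I hw) (kanA_op hw hy) /koD.
rewrite (jmulC hy hw) !mulZ_fun.
rewrite (scommE (mul_lin w) (mul_homog hw) (mul_lin y) (mul_homog hy)).
rewrite (scommE (mul_lin y) (mul_homog hy) (mul_lin w) (mul_homog hw)).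
rewrite -[LHS]scale1r -[X in X *: _ = _](mulVf two_neq0) -scalerA; congr (_ *: _).
by koszul.
Qed.

Lemma sflip_ev_koD x w :
  sflip (@pr_bil K V) (pr V) (fun (C : V -> V -> V) z => C z) x (kanA w) =
  koD x (2%:R^-1 *: w).
Proof.
have gV := graded_space V; have S := sflip_bilin gV gV koD_bilin.
have sV := gr_subspace gV.
rewrite (bilinZr sV koD_bilin) //.
have g := graded_bil V; have S' := sflip_bilin g gV (ev_bilin V).
have B := koD_bilin.
apply: (bilin_ext (op := fun x w => sflip (@pr_bil K V) (pr V)
    (fun (C : V -> V -> V) z => C z) x (kanA w))
  (op' := fun x w => 2%:R^-1 *: koD x w) gV gV) => //.
- split=> c y z t _ _ _; first by rewrite S'.1 //; apply: kanA_bil.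
  by rewrite kanAP S'.2 //; apply: kanA_bil.
- split=> c y z t _ _ _; first by rewrite B.1 //; lmod_ring.
  by rewrite B.2 //; lmod_ring.
move=> i j {}x {}w _ hx _ hw.
rewrite (sflipE g gV (ev_bilin V) (kanA_bil w) (kanA_homog hw) I hx).
rewrite (kanA_op hw hx) /koD (jmulC hw hx) !mulZ_fun.
rewrite (scommE (mul_lin w) (mul_homog hw) (mul_lin x) (mul_homog hx)).
rewrite (scommE (mul_lin x) (mul_homog hx) (mul_lin w) (mul_homog hw)).
rewrite -[LHS]scale1r -[X in X *: _ = _](mulVf two_neq0) -scalerA; congr (_ *: _).
by koszul.
Qed.

Lemma kan_to_koE x a u :
  kan_to_ko (x, a, kanA u) = (x, (a, theta e a), 2%:R^-1 *: u).
Proof. by rewrite /kan_to_ko /= half_kanA. Qed.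

Lemma kan_to_ko_bracket X Y : kan_carrier X -> kan_carrier Y ->
  kan_to_ko (kan_bracket X Y) = ko_bracket (kan_to_ko X) (kan_to_ko Y).
Proof.
case: X => [[x a] A]; case: Y => [[y b] B] [/= ia /(kan_posP he) [u ->]].
move=> [/= ib /(kan_posP he) [v ->]].
rewrite !half_kanA; set u' := 2%:R^-1 *: u; set v' := 2%:R^-1 *: v.
have E2 : scomm a b + kanA u y + sflip (@pr_bil K V) (pr V)
     (fun (C : V -> V -> V) z => C z) x (kanA v) =
   scomm a b + koD x v' + sflip (pr V) (pr V) (@koD K V) u' y.
  by rewrite sflip_ev_koD kanA_koD; lmod_ring.
rewrite /ko_bracket /kan_to_ko; congr (_, _, _); rewrite /=.
- set R := (X in _ = X).
  have iR : inn R.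
    have s := inn_subspace; have D p q : inn (koDD p q).
      by apply: span_gen; exists p, q.
    rewrite /R; apply: (subspaceD s); first apply: (subspaceD s) => //.
      apply/innP; split; first exact: istr_scomm he _ _ ia ib.
      by rewrite /= (theta_scomm he).
    rewrite /sflip !big_bool; apply: (subspaceN s).
    by do ! apply: (subspaceD s); apply: (subspaceZ s).
  have [_ R2] := (innP R).1 iR; rewrite [RHS]surjective_pairing R2.
  have -> : R.1 = scomm a b + koD x v' + sflip (pr V) (pr V) (@koD K V) u' y.
    by rewrite /R /sflip !big_bool.
  by rewrite -E2.
- have gE := graded_istr V; have lt f : istrV f -> linear (theta e f).
    by move=> /istr_lin; apply: theta_lin.
  have ib' i : istrV (pr_end i b) by apply: (gr_closed gE).
  have tb i : pr_end i (theta e b) = theta e (pr_end i b) by apply: pr_end_theta.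
  rewrite /sflip !big_bool /= !tb !pr_bil_kanA !(act_istr_kanA he) //.
  rewrite -!kanAZ -!kanAD -kanAN -kanAD half_kanA !linearZ /=.
  by rewrite !(linZ (lt _ (ib' _))) (linZ (lt _ ia)); lmod_ring.
Qed.

Lemma istr_theta_inn a : istrV a -> inn (a, theta e a).
Proof. by move=> ia; apply/innP. Qed.

Lemma kan_ko_isomorphic : lie_superalgebra_isomorphic (Kan V) (Ko V).
Proof.
apply: (@lie_transport K (Kan V) (Ko V) kan_to_ko ko_to_kan).
- exact: kan_lie he.
- split; first exact: subspace0 inn_subspace.
  by move=> a X Y; case: inn_subspace => _; apply.
- by move=> X [iX _]; apply: istr_theta_inn.
- move=> Y /innP [iY _]; split=> //; exact: (kan_pos_kanA he).
- move=> [[x a] A] [/= ia /(kan_posP he) [u ->]].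
  by rewrite kan_to_koE /ko_to_kan /= scalerA divff // scale1r.
- move=> [[x [a b]] v] /innP [/= ia ->].
  by rewrite kan_to_koE /= scalerA mulVf // scale1r.
- move=> c X Y cX cY; rewrite /kan_to_ko /= thetaP.
  congr (_, _, _); rewrite /= !fctE; lmod_ring.
- move=> i X [[iX kX] h1 h2 h3]; split=> //.
  + exact: istr_theta_inn.
  + by split=> //; apply: (theta_homog he).
  + by apply: homogZ; have := h3 _ _ _ _ e0 e0; rewrite !addbF.
- move=> i Y [/innP [iY _] h1 [h2 _] h3]; split=> //=.
  + by split=> //; apply: (kan_pos_kanA he).
  + exact/kanA_homog/homogZ.
- by move=> i Y [].
- exact: kan_to_ko_bracket.
Qed.
End Koecher.

Theorem proposition4p3 (K : fieldType)
    (hK2 : 2%N \notin GRing.pchar K) (hK3 : 3%N \notin GRing.pchar K)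
    (V : jordanSuperalgebra K) (hV : unital V) :
  lie_superalgebra_isomorphic (Kan V) (Ko V).
Proof.
case: hV => e he; apply: (kan_ko_isomorphic he).
by apply: contraNneq hK2 => h2; rewrite inE /= h2 eqxx.
Qed.
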